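(* Let $A_1,A_2\in\mathbb{R}^{2\times2}$ and let $P_0,P_1,P_2$ be three totally-real planes in $\mathbb{C}^2$ given by $$P_0=\mathbb{R}^2,\qquad P_j=(A_j+i\mathbb{I})\mathbb{R}^2,\quad j=1,2.$$ Assume that the pairwise unions of $P_0,P_1,P_2$ are locally polynomially convex at $0\in\mathbb{C}^2$. Assume further that (i) $\det A_1=0$ and $\det A_2\ge0$; (ii) $\det[A_1,A_2]>0$. Then $P_0\cup P_1\cup P_2$ is locally polynomially convex at the origin.
   Context: $\mathbb{I}$ is the $2\times2$ identity matrix and $[A_1,A_2]=A_1A_2-A_2A_1$. A plane is a 2-dimensional real subspace $P$ of $\mathbb{C}^2$; it is totally real if $P\cap iP=\{0\}$. For a compact set $K\subset\mathbb{C}^n$, the polynomially convex hull is $\widehat{K}=\{z\in\mathbb{C}^n: |p(z)|\le\sup_K|p| \text{ for all } p\in\mathbb{C}[z_1,\dots,z_n]\}$; $K$ is polynomially convex if $\widehat{K}=K$. A closed set $E\subset\mathbb{C}^n$ is locally polynomially convex at $p\in E$ if $E\cap\overline{B(p;r)}$ is polynomially convex for some $r>0$, where $B(p;r)$ is the open ball with centre $p$ and radius $r$. *)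

(* Defs.v *)
From mathcomp Require Import all_boot all_order all_algebra.
From mathcomp Require Import boolp classical_sets reals.
From mathcomp Require Import complex.
From mathcomp Require Import mpoly.

Set Implicit Arguments.
Unset Strict Implicit.
Unset Printing Implicit Defensive.

Import Order.TTheory GRing.Theory Num.Theory.
Local Open Scope classical_set_scope.
Local Open Scope ring_scope.
Local Open Scope complex_scope.

Section PolynomialConvexity.
Context {R : realType} {n : nat}.
Implicit Types (K E : set 'cV[R[i]]_n) (z p : 'cV[R[i]]_n).

Definition poly_val (f : {mpoly R[i][n]}) z : R[i] :=
  f.@[fun i => z i ord0].

(* Meant for compact K. [sup] is then a genuine supremum when K is nonempty;
   for K empty, sup set0 = 0 and the hull is empty. *)
Definition poly_hull K : set 'cV[R[i]]_n :=
  [set z | forall f : {mpoly R[i][n]},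
     ComplexField.Normc.normc (poly_val f z)
       <= sup [set ComplexField.Normc.normc (poly_val f w) | w in K]].

Definition polynomially_convex K : Prop := poly_hull K = K.

(* The Euclidean (hermitian) norm; the norm that MathComp-Analysis puts on
   matrices is the max norm. *)
Definition euclidean_norm z : R :=
  Num.sqrt (\sum_(i < n) ComplexField.Normc.normc (z i ord0) ^+ 2).

(* For r > 0 this is the closure of the open ball B(p; r). *)
Definition closed_euclidean_ball p (r : R) : set 'cV[R[i]]_n :=
  [set z | euclidean_norm (z - p) <= r].

(* Meant for closed E containing p, so that the intersection is compact and
   nonempty. *)
Definition locally_polynomially_convex E p : Prop :=
  exists2 r : R, 0 < r & polynomially_convex (E `&` closed_euclidean_ball p r).

End PolynomialConvexity.

Section Planes.
Context {R : realType}.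
Implicit Types (P : set 'cV[R[i]]_2).

Definition real_plane P : Prop :=
  exists v w : 'cV[R[i]]_2,
    (forall a b : R, a%:C *: v + b%:C *: w = 0 -> a = 0 /\ b = 0) /\
    P = [set z | exists a b : R, z = a%:C *: v + b%:C *: w].

(* %C is needed: in ring_scope 'i is Num.imaginary, an abstractly chosen square
   root of -1, instead of Complex 0 1. *)
Definition totally_real P : Prop :=
  P `&` [set 'i%C *: z | z in P] = [set 0].

Definition complexify {m k : nat} (A : 'M[R]_(m, k)) : 'M[R[i]]_(m, k) :=
  map_mx (real_complex R) A.

Definition image_of_R2 (M : 'M[R[i]]_2) : set 'cV[R[i]]_2 :=
  range (fun x : 'cV[R]_2 => M *m complexify x).

Definition commutator (A B : 'M[R]_2) : 'M[R]_2 := A *m B - B *m A.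

End Planes.

(* Main.v *)
(** Let C = [A1, A2].  Since tr C = 0 and det C > 0, the product of C with the
    rotation by a right angle is, up to sign, a positive definite symmetric Q,
    and tr (C A_j) = 0 says that Q A_j is symmetric; as det A_j >= 0, both Q A_j
    are semidefinite.  Put phi(z) = z^T Q z, so that on P_j
      phi((A_j + i) x) = x^T (A_j^T Q A_j - Q) x + 2 i x^T Q A_j x.
    If the Q A_j have the same sign e, then psi = (h + e i) phi, h > 0 small, maps
    P_1 and P_2 into {Re <= 0} and P_0 into a ray of {Re > 0}.  If the signs are
    e and -e, then psi = e i phi - h z^T (e Q A_1) z maps P_0 and P_1 into
    {Re <= 0} and P_2 into a sector of {Re > 0}.  Either way Kallin's lemma
    reduces the claim to a pairwise union and a single totally real plane.
    Kallin's lemma needs polynomials that are uniformly bounded on a half-disc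
    and a sector touching at 0, and close to 0 and 1 respectively away from 0;
    they approximate (1 + l w / sqrt ((1 - l conj(a) w) (1 - l a w))) / 2, where
    the unit vectors a and conj(a) point into the two gaps. *)

Require Import Defs.
From mathcomp Require Import all_boot all_order all_algebra.
From mathcomp Require Import boolp classical_sets reals.
From mathcomp Require Import complex mpoly.
From mathcomp Require Import ring lra.

Set Implicit Arguments.
Unset Strict Implicit.
Unset Printing Implicit Defensive.

Import Order.TTheory GRing.Theory Num.Theory.
Import ComplexField.Normc.
Local Open Scope classical_set_scope.
Local Open Scope ring_scope.
Local Open Scope complex_scope.

Local Notation Re := complex.Re.
Local Notation Im := complex.Im.

(** * Moduli and uniform approximation by polynomials *)

Section Modulus.
Context {R : realType}.
Implicit Types (z w : R[i]) (x y : R).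

Lemma normc_ge0 z : 0 <= normc z.
Proof. by case: z => a b; apply: sqrtr_ge0. Qed.

Lemma normc_sqr z : normc z ^+ 2 = Re z ^+ 2 + Im z ^+ 2.
Proof. by case: z => a b /=; rewrite sqr_sqrtr ?addr_ge0 ?sqr_ge0. Qed.

Lemma normc_real x : normc x%:C = `|x|.
Proof. by rewrite /= expr0n addr0 sqrtr_sqr. Qed.

Lemma normcX z n : normc (z ^+ n) = normc z ^+ n.
Proof. by elim: n => [|n IH]; rewrite ?expr0 ?normc1 // !exprS normcM IH. Qed.

Lemma normc_distC z w : normc (z - w) = normc (w - z).
Proof. by rewrite -normcN opprB. Qed.

Lemma normc_triangle v z w : normc (z - w) <= normc (z - v) + normc (v - w).
Proof. by apply: le_trans (le_normcD _ _); rewrite addrA subrK. Qed.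

Lemma normcB_le z w : normc (z - w) <= normc z + normc w.
Proof. by rewrite -[normc w]normcN; apply: le_normcD. Qed.

Lemma normc_le_dist z w : normc z - normc w <= normc (z - w).
Proof. by rewrite lerBlDr; apply: le_trans (le_normcD _ _); rewrite subrK. Qed.

Lemma Re_mulc z w : Re (z * w) = Re z * Re w - Im z * Im w.
Proof. by case: z w => [a b] [c d]. Qed.

Lemma Im_mulc z w : Im (z * w) = Re z * Im w + Im z * Re w.
Proof. by case: z w => [a b] [c d]. Qed.

Lemma Re_addc z w : Re (z + w) = Re z + Re w.
Proof. by case: z w => [a b] [c d]. Qed.

Lemma Im_addc z w : Im (z + w) = Im z + Im w.
Proof. by case: z w => [a b] [c d]. Qed.

Lemma Re_oppc z : Re (- z) = - Re z.
Proof. by case: z. Qed.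

Lemma Im_oppc z : Im (- z) = - Im z.
Proof. by case: z. Qed.

Lemma Re_le_normc z : Re z <= normc z.
Proof.
have := normc_sqr z; have := normc_ge0 z; move: (normc z) => n; nra.
Qed.

Lemma geN_normc_Re z : - normc z <= Re z.
Proof.
have := normc_sqr z; have := normc_ge0 z; move: (normc z) => n; nra.
Qed.

Lemma normc_le_ReIm z : normc z <= `|Re z| + `|Im z|.
Proof.
have := normc_sqr z; have := normc_ge0 z.
rewrite -(real_normK (num_real (Re z))) -(real_normK (num_real (Im z))).
have := normr_ge0 (Re z); have := normr_ge0 (Im z).
move: (normc z) `|Re z| `|Im z| => n a b; nra.
Qed.

Lemma normc_gt0 z : (0 < normc z) = (z != 0).
Proof.
rewrite lt_def normc_ge0 andbT; congr negb; apply/eqP/eqP=> [/eq0_normc //|->].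
exact: normc0.
Qed.

(** Bernoulli's inequality for 1 / x, followed by the Archimedean property. *)
Lemma geom_small x y : 0 <= x -> x < 1 -> 0 < y -> exists n, x ^+ n < y.
Proof.
move=> x0 x1 y0; case: (eqVneq x 0) => [->|xn0].
  by exists 1%N; rewrite expr1.
have xp : 0 < x by rewrite lt_def xn0.
have dp : 0 < x^-1 - 1 by rewrite subr_gt0 invf_gt1.
have bern n : 1 + (x^-1 - 1) *+ n <= x^-1 ^+ n.
  elim: n => [|n IH]; first by rewrite mulr0n addr0 expr0.
  rewrite exprS mulrS.
  have ge0 : 0 <= (x^-1 - 1) *+ n by rewrite mulrn_wge0 // ltW.
  move: IH ge0 dp; move: x^-1 => t; move: (_ *+ n) (_ ^+ n) => u v; nra.
have [n hn] : exists n, y^-1 < (x^-1 - 1) *+ n.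
  exists (Num.bound (y^-1 / (x^-1 - 1))).
  rewrite -mulr_natl -ltr_pdivrMr //; apply: archi_boundP.
  by rewrite divr_ge0 ?invr_ge0 ?ltW.
exists n; rewrite -[x ^+ n]invrK -[y]invrK ltf_pV2 ?posrE ?invr_gt0 ?exprn_gt0 //.
rewrite -exprVn; apply: lt_le_trans hn (le_trans _ (bern n)).
by rewrite lerDr.
Qed.

End Modulus.

Section Approximation.
Context {R : realType}.
Implicit Types (Y : set R[i]) (g h : R[i] -> R[i]).

Definition poly_approx Y g := forall e : R, 0 < e ->
  exists p : {poly R[i]}, forall w, Y w -> normc (p.[w] - g w) <= e.

Lemma poly_approx_horner Y (p : {poly R[i]}) : poly_approx Y (fun w => p.[w]).
Proof. by move=> e e0; exists p => w _; rewrite subrr normc0 ltW. Qed.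

Lemma poly_approx_ext Y g h :
  (forall w, Y w -> g w = h w) -> poly_approx Y g -> poly_approx Y h.
Proof.
by move=> gh ag e /ag[p hp]; exists p => w Yw; rewrite -gh //; apply: hp.
Qed.

Lemma poly_approxD Y g h :
  poly_approx Y g -> poly_approx Y h -> poly_approx Y (fun w => g w + h w).
Proof.
move=> ag ah e e0; have e2 : 0 < e / 2 by lra.
have [[p hp] [q hq]] := (ag _ e2, ah _ e2).
exists (p + q) => w Yw; rewrite hornerD opprD addrACA.
by apply: le_trans (le_normcD _ _) _; have := hp w Yw; have := hq w Yw; lra.
Qed.

Lemma poly_approxM Y g h (B : R) :
    (forall w, Y w -> normc (g w) <= B) -> (forall w, Y w -> normc (h w) <= B) ->
  poly_approx Y g -> poly_approx Y h -> poly_approx Y (fun w => g w * h w).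
Proof.
move=> bg bh ag ah e e0; pose B1 := 1 + `|B|.
have B1_ge1 : 1 <= B1 by rewrite lerDl.
have BB1 : B <= B1 by rewrite (le_trans (ler_norm _)) // lerDr.
(* Errors of at most d <= 1 in both factors change the product by at most d^2 + 2 B1 d <= d (2 B1 +
   1). *)
pose d := Num.min 1 (e / (2 * B1 + 1)).
have K0 : 0 < 2 * B1 + 1 by lra.
have d0 : 0 < d by rewrite lt_min ltr01 divr_gt0.
have d1 : d <= 1 by rewrite ge_min lexx.
have de : d * (2 * B1 + 1) <= e by rewrite -ler_pdivlMr // ge_min lexx orbT.
have [[p hp] [q hq]] := (ag _ d0, ah _ d0).
exists (p * q) => w Yw; rewrite hornerM.
have -> : p.[w] * q.[w] - g w * h w =
  (p.[w] - g w) * (q.[w] - h w) + ((p.[w] - g w) * h w + g w * (q.[w] - h w)).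
  by ring.
apply: le_trans (le_normcD _ _) _.
apply: le_trans (lerD (lexx _) (le_normcD _ _)) _.
rewrite !normcM.
move: (hp w Yw) (hq w Yw) (bg w Yw) (bh w Yw).
move: (normc_ge0 (p.[w] - g w)) (normc_ge0 (q.[w] - h w)).
move: (normc_ge0 (g w)) (normc_ge0 (h w)).
move: (normc (p.[w] - g w)) (normc (q.[w] - h w)) (normc (g w)) (normc (h w)).
move=> P Q G H G0 H0 P0 Q0 Pd Qd GB HB.
have : P * Q <= d * 1 by apply: ler_pM => //; lra.
have : P * H <= d * B1 by apply: ler_pM => //; lra.
have : G * Q <= B1 * d by apply: ler_pM => //; lra.
lra.
Qed.

Lemma poly_approx_lim Y g :
  (forall e : R, 0 < e -> exists2 h, poly_approx Y h &
     forall w, Y w -> normc (h w - g w) <= e) -> poly_approx Y g.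
Proof.
move=> H e e0; have e2 : 0 < e / 2 by lra.
have [h ah hg] := H _ e2; have [p hp] := ah _ e2.
exists p => w Yw; apply: le_trans (normc_triangle (h w) _ _) _.
by have := hp w Yw; have := hg w Yw; lra.
Qed.

Lemma poly_approx_scale Y Z g (a : R[i]) :
    (forall w, Z w -> Y (a * w)) ->
  poly_approx Y g -> poly_approx Z (fun w => g (a * w)).
Proof.
move=> ZY ag e /ag[p hp]; exists (p \Po (a *: 'X)) => w Zw.
by rewrite horner_comp hornerZ hornerX; apply: hp; apply: ZY.
Qed.

Lemma Re_sqrtc_ge0 (z : R[i]) : 0 <= Re (sqrtc z).
Proof. by case: z => a b; apply: sqrtr_ge0. Qed.

Lemma sqrtc_unique (s v : R[i]) : 0 < Re s -> s ^+ 2 = v -> s = sqrtc v.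
Proof.
move=> s0 sv; have /eqP := sqr_sqrtc v; rewrite -{2}sv eqf_sqr => /orP[/eqP//|/eqP E].
have := Re_sqrtc_ge0 v; by rewrite E Re_oppc oppr_ge0 leNgt s0.
Qed.

Lemma normc_sqrtc (v : R[i]) : normc (sqrtc v) ^+ 2 = normc v.
Proof. by rewrite -normcX sqr_sqrtc. Qed.

(** With s the root, x = (1 - s)(1 + s), and |1 + s| >= 1 because Re s >= 0. *)
Lemma normc_sqrtc_sub1 (x : R[i]) : normc (sqrtc (1 - x) - 1) <= normc x.
Proof.
have := sqr_sqrtc (1 - x); have := Re_sqrtc_ge0 (1 - x).
move: (sqrtc _) => s s0 s2.
have E : x = (1 - s) * (1 + s) by rewrite -[LHS]opprK -[- x](addrK 1) [- x + 1]addrC -s2; ring.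
rewrite normc_distC E normcM.
have s1 : 1 <= normc (1 + s).
  by apply: le_trans (Re_le_normc _); case: (s) s0 => a b /=; lra.
by rewrite ler_peMr // normc_ge0.
Qed.

(* [(1 + y)^2 (1 - x) = 1] rewritten as a fixed-point equation for [y]. *)
Definition invsqrt_step (x y : R[i]) : R[i] :=
  2^-1 * (x * (1 + y) ^+ 2 - y ^+ 2).

Lemma normc_half : normc (2^-1 : R[i]) = 2^-1.
Proof.
rewrite normcV; congr (_^-1).
have -> : (2 : R[i]) = (2 : R)%:C by rewrite rmorph_nat.
by rewrite normc_real ger0_norm.
Qed.

Lemma half2 : 2^-1 * 2 = 1 :> R[i].
Proof. by rewrite mulVf // pnatr_eq0. Qed.

Lemma invsqrt_stepP (x : R[i]) (y := (sqrtc (1 - x))^-1 - 1) :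
  normc x <= 8^-1 -> normc y <= 4^-1 /\ invsqrt_step x y = y.
Proof.
move=> x8; have := normc_sqrtc_sub1 x; have := sqr_sqrtc (1 - x).
rewrite /y {y}; move: (sqrtc _) => s s2 sx.
have s78 : 7 / 8 <= normc s.
  have := normc_le_dist 1 s; rewrite normc1 normc_distC => ?; lra.
have sn0 : s != 0 by rewrite -normc_gt0; lra.
have E : s^-1 - 1 = - (s - 1) * s^-1.
  by rewrite opprB mulrBl mulfV // mul1r.
split.
  (* Here |s - 1| <= 1/8 and |s| >= 7/8, so |y| <= 1/7. *)
  rewrite E normcM normcN normcV ler_pdivrMr; lra.
have {s2}xE : x = 1 - s ^+ 2 by rewrite s2; ring.
rewrite /invsqrt_step xE; by field.
Qed.

Lemma invsqrt_step_small (x y : R[i]) :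
  normc x <= 8^-1 -> normc y <= 4^-1 -> normc (invsqrt_step x y) <= 4^-1.
Proof.
move=> hx hy; rewrite /invsqrt_step normcM normc_half.
have := normcB_le (x * (1 + y) ^+ 2) (y ^+ 2); rewrite normcM !normcX.
have := le_normcD 1 y; rewrite normc1.
move: (normc_ge0 (1 + y)) (normc_ge0 x) (normc_ge0 y) hx hy.
move: (normc (_ - _)) => d.
move: (normc (1 + y)) (normc x) (normc y) => a b c a0 b0 c0 hb hc ha hd.
have h1 : a * a <= 5/4 * (5/4) by apply: ler_pM => //; lra.
have h2 : c * c <= 4^-1 * 4^-1 by apply: ler_pM => //; lra.
have h3 : b * (a * a) <= 8^-1 * (5/4 * (5/4)) by apply: ler_pM; rewrite ?mulr_ge0.
rewrite !expr2 in hd *; lra.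
Qed.

(** The difference is (y - z) / 2 times x (2 + y + z) - (y + z), whose modulus is at most 5/16 + 1/2
    < 1. *)
Lemma invsqrt_step_contract (x y z : R[i]) :
    normc x <= 8^-1 -> normc y <= 4^-1 -> normc z <= 4^-1 ->
  normc (invsqrt_step x y - invsqrt_step x z) <= 2^-1 * normc (y - z).
Proof.
move=> hx hy hz.
have -> : invsqrt_step x y - invsqrt_step x z =
    2^-1 * ((y - z) * (x * (2 + (y + z)) - (y + z))).
  by rewrite /invsqrt_step; ring.
rewrite !normcM normc_half ler_pM2l ?invr_gt0 // ler_piMr ?normc_ge0 //.
apply: le_trans (normcB_le _ _) _; rewrite normcM.
have := le_normcD 2 (y + z); have := le_normcD y z.
have -> : normc (2 : R[i]) = 2 by rewrite -[2]invrK normcV normc_half invrK.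
move: (normc_ge0 (2 + (y + z))) (normc_ge0 x) hx hy hz.
move: (normc (2 + _)) (normc (y + z)) (normc x) (normc y) (normc z) => a b c d e *.
have : c * a <= 8^-1 * (5 / 2) by apply: ler_pM => //; lra.
lra.
Qed.

(** The iterates of [invsqrt_step (g w)] from 0 are polynomials in g w, hence approximable on Y. By
    contraction they converge geometrically, uniformly on Y, to the fixed point (1 - g w)^(-1/2) -
    1. *)
Lemma poly_approx_invsqrt Y g :
    poly_approx Y g -> (forall w, Y w -> normc (g w) <= 8^-1) ->
  poly_approx Y (fun w => (sqrtc (1 - g w))^-1).
Proof.
move=> ag g8; pose it k w := iter k (invsqrt_step (g w)) 0.
have it4 k w : Y w -> normc (it k w) <= 4^-1.
  move=> Yw; elim: k => [|k IH]; first by rewrite [it _ _]/(0 : R[i]) normc0 invr_ge0.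
  by rewrite /it /=; apply: invsqrt_step_small => //; apply: g8.
have cst (c : R[i]) : poly_approx Y (fun=> c).
  by apply: (poly_approx_ext _ (@poly_approx_horner Y c%:P)) => w _; rewrite hornerC.
have ait k : poly_approx Y (it k).
  elim: k => [|k IH]; first exact: cst.
  rewrite /it /= -/(it k); rewrite /invsqrt_step.
  have n1 w : Y w -> normc (1 + it k w) <= 2.
    move=> Yw; apply: le_trans (le_normcD _ _) _; rewrite normc1.
    by have := it4 k w Yw; rewrite /it; lra.
  have it2 w : Y w -> normc (it k w) <= 2.
    by move=> /(it4 k); lra.
  have sq f : (forall w, Y w -> normc (f w) <= 2) -> poly_approx Y f ->
      poly_approx Y (fun w => f w ^+ 2) /\ forall w, Y w -> normc (f w ^+ 2) <= 4.
    move=> f2 af; split.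
      by apply: poly_approx_ext (poly_approxM f2 f2 af af) => w _; rewrite expr2.
    move=> w Yw; rewrite normcX; have := f2 w Yw; have := normc_ge0 (f w).
    move: (normc _) => t; nra.
  have [a1 b1] := sq _ n1 (poly_approxD (cst 1) IH).
  have [a2 b2] := sq _ it2 IH.
  have a3 : poly_approx Y (fun w => g w * (1 + it k w) ^+ 2).
    by apply: (poly_approxM (B := 4) _ b1 ag a1) => w /g8 ?; lra.
  have b3 w : Y w -> normc (g w * (1 + it k w) ^+ 2) <= 4.
    move=> /[dup] /g8 ? /b1 ?; rewrite normcM.
    have : normc (g w) * normc ((1 + it k w) ^+ 2) <= 8^-1 * 4.
      by apply: ler_pM => //; apply: normc_ge0.
    lra.
  have a4 : poly_approx Y (fun w => (-1) * (it k w) ^+ 2).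
    apply: (poly_approxM (B := 4) _ b2 (cst _) a2) => w _.
    by rewrite normcN normc1; lra.
  have a5 := poly_approxD a3 a4.
  apply: (poly_approx_ext _ (poly_approxM (B := 8) _ _ (cst 2^-1) a5)) => w Yw.
  - by rewrite mulN1r.
  - by rewrite normc_half; lra.
  - apply: le_trans (le_normcD _ _) _; rewrite mulN1r normcN.
    by have := b3 w Yw; have := b2 w Yw; lra.
apply: poly_approx_lim => e e0.
have [k hk] : exists k, (2^-1 : R) ^+ k < e by apply: geom_small => //; lra.
exists (fun w => 1 + it k w) => [|w Yw]; first exact: poly_approxD (cst 1) (ait k).
have [] := invsqrt_stepP (g8 w Yw); set y := _ - 1 => y4 yE.
have -> : 1 + it k w - (sqrtc (1 - g w))^-1 = it k w - y by rewrite /y; ring.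
apply: le_trans (ltW hk).
elim: (k) => [|j IH].
  by rewrite [it _ _]/(0 : R[i]) sub0r normcN expr0; apply: le_trans y4 _; lra.
rewrite [it _ _]/(invsqrt_step (g w) (it j w)) -yE [_ ^+ j.+1]exprS.
apply: le_trans (invsqrt_step_contract (g8 w Yw) (it4 j w Yw) y4) _.
by rewrite ler_pM2l ?invr_gt0.
Qed.

End Approximation.

(** * Polynomial approximation of inverse square roots *)

Section InverseSquareRoot.
Context {R : realType}.
Implicit Types (u v w x : R[i]) (c l M : R).

Lemma sqr_normc_sub1 l u :
  normc (1 - l%:C * u) ^+ 2 = 1 - 2 * l * Re u + l ^+ 2 * normc u ^+ 2.
Proof.
by rewrite !normc_sqr Re_addc Re_oppc Re_mulc Im_addc Im_oppc Im_mulc /=; ring.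
Qed.

(** With b = l |u|, the squared modulus is at least 1 - 2 c b + b^2, which equals both (b - c)^2 +
    (1 - c^2) and (c b - 1)^2 + (1 - c^2) b^2. *)
Lemma sector_dist_ge c l u : 0 <= c < 1 -> 0 <= l -> Re u <= c * normc u ->
  1 - c ^+ 2 <= normc (1 - l%:C * u) ^+ 2 /\
  (1 - c ^+ 2) * (l * normc u) ^+ 2 <= normc (1 - l%:C * u) ^+ 2.
Proof.
move=> /andP[c0 c1] l0 uc; rewrite sqr_normc_sub1.
have H : l * Re u <= c * (l * normc u).
  by rewrite mulrCA ler_wpM2l.
have -> : 2 * l * Re u = 2 * (l * Re u) by ring.
have -> : l ^+ 2 * normc u ^+ 2 = (l * normc u) ^+ 2 by ring.
move: H; move: (l * Re u) (l * normc u) => a b H.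
have := sqr_ge0 (c * b - 1); have := sqr_ge0 (b - c).
by split; nra.
Qed.

(** With b = l |u|, the sum is at least (1 - c b) + c (b - 1) = 1 - c. So 1 - l u keeps an angular
    distance from the cut of [sqrtc], as [sqrtc_mul_near1] requires. *)
Lemma sector_Re_ge c l u : 0 <= c < 1 -> 0 <= l -> Re u <= c * normc u ->
  0 <= Re (1 - l%:C * u) + c * normc (1 - l%:C * u).
Proof.
move=> /andP[c0 c1] l0 uc.
have H : l * Re u <= c * (l * normc u) by rewrite mulrCA ler_wpM2l.
have := normc_le_dist (l%:C * u) 1; rewrite normc_distC normc1 normcM normc_real.
rewrite (ger0_norm l0) Re_addc Re_oppc Re_mulc /= mul0r subr0.
move: H; move: (l * Re u) (l * normc u) (normc _) => a b d *; nra.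
Qed.

(** The product of the two roots is a root; it is the principal one once its real part is positive.
    For s = sqrt v the sector condition gives 2 (Re s)^2 >= (1 - c) |s|^2, while multiplying s by
    sqrt (1 - x) moves it by at most |s| (1 - c) / 8 < Re s. *)
Lemma sqrtc_mul_near1 c v x : 0 <= c < 1 -> v != 0 ->
    0 <= Re v + c * normc v -> normc x <= (1 - c) / 8 ->
  sqrtc (v * (1 - x)) = sqrtc v * sqrtc (1 - x).
Proof.
move=> /andP[c0 c1] v0 vc xc; apply/esym/sqrtc_unique; last first.
  by rewrite exprMn !sqr_sqrtc.
have tx := normc_sqrtc_sub1 x; have s0 := Re_sqrtc_ge0 v.
have := sqr_sqrtc v; have sn := normc_sqrtc v.
move: (sqrtc v) s0 sn => s s0 sn sv.
set t := sqrtc _ in tx *.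
have -> : s * t = s + s * (t - 1) by ring.
rewrite Re_addc.
have D := geN_normc_Re (s * (t - 1)); rewrite normcM in D.
have Rv : Re v = Re s ^+ 2 - Im s ^+ 2 by rewrite -sv expr2 Re_mulc; ring.
have ns : 0 < normc s by rewrite normc_gt0; apply: contraNneq v0 => s00; rewrite -sv s00 expr0n.
have nd : normc s * normc (t - 1) <= normc s * ((1 - c) / 8).
  by rewrite ler_wpM2l ?normc_ge0 // (le_trans tx).
suff : normc s * ((1 - c) / 8) < Re s by lra.
have nR := normc_sqr s.
rewrite -sn in vc; move: (normc s) (Re s) (Im s) (Re v) ns s0 nR Rv vc => n a b r.
move=> n0 a0 nE rE vc.
have H : (1 - c) * n ^+ 2 <= 2 * a ^+ 2 by nra.
rewrite ltNge; apply/negP => an.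
have K : a ^+ 2 <= (n * ((1 - c) / 8)) ^+ 2.
  by rewrite lerXn2r ?nnegrE // mulr_ge0 ?ltW // divr_gt0 // subr_gt0.
have n2 : 0 < n ^+ 2 by rewrite exprn_gt0.
have : 0 < (1 - c) * n ^+ 2 by rewrite mulr_gt0 // subr_gt0.
move: K H; rewrite exprMn; move: (n ^+ 2) (a ^+ 2) => N A K H P.
have : (1 - c) * ((1 - c) * N) <= (1 - c) * N by rewrite ler_piMl; lra.
have E : N * ((1 - c) / 8) ^+ 2 = 64^-1 * ((1 - c) * ((1 - c) * N)) by field.
by rewrite E in K; lra.
Qed.

Definition invsqrt l u := (sqrtc (1 - l%:C * u))^-1.

(** The open sector removed around the positive axis contains the branch points 1 / l of [invsqrt l]
    for all l > 0. *)
Definition slit_disc c M : set R[i] := [set u | normc u <= M /\ Re u <= c * normc u].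

Lemma normc_invsqrt_sqr l u :
  normc (invsqrt l u) ^+ 2 = (normc (1 - l%:C * u))^-1.
Proof. by rewrite normcV exprVn normc_sqrtc. Qed.

Lemma sector_normc_ge c l u : 0 <= c < 1 -> 0 <= l -> Re u <= c * normc u ->
  1 - c ^+ 2 <= normc (1 - l%:C * u).
Proof.
move=> cc l0 /(sector_dist_ge cc l0)[+ _]; move/andP: cc => [c0 c1].
have := normc_ge0 (1 - l%:C * u); move: (normc _) => n; nra.
Qed.

Lemma normc_invsqrt_le c l u : 0 <= c < 1 -> 0 <= l -> Re u <= c * normc u ->
  normc (invsqrt l u) <= (1 - c ^+ 2)^-1.
Proof.
move=> cc l0 uc; have := sector_normc_ge cc l0 uc.
have d0 : 0 < 1 - c ^+ 2 by move/andP: cc => [? ?]; nra.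
have i1 : 1 <= (1 - c ^+ 2)^-1 by rewrite invf_ge1 //; nra.
move=> H; have n0 := lt_le_trans d0 H; move: H; rewrite -lef_pV2 ?posrE //.
rewrite -normc_invsqrt_sqr; have := normc_ge0 (invsqrt l u).
move: (normc _) (_^-1) i1 => a b *; nra.
Qed.

(* Increasing [l] in small steps moves the branch point [1 / l] of [invsqrt l]
   along the removed sector from infinity, where [invsqrt 0 = 1]. *)
Lemma poly_approx_invsqrt_slit c M l : 0 <= c < 1 -> 0 <= l ->
  poly_approx (slit_disc c M) (invsqrt l).
Proof.
move=> cc l0; have /andP[c0 c1] := cc.
have d0 : 0 < 1 - c ^+ 2 by nra.
(* Once l K <= n + 1, the increment h = l / (n + 1) satisfies h |M| / (1 - c^2) <= (1 - c) / 8, the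
   perturbation allowed by [sqrtc_mul_near1]. *)
pose K := `|M| * 8 / ((1 - c ^+ 2) * (1 - c)).
have [n hn] : exists n : nat, l * K < n%:R.
  exists (Num.bound (l * K)); apply: archi_boundP.
  by rewrite mulr_ge0 // divr_ge0 // ?mulr_ge0 // ltW // subr_gt0.
pose h := l / n.+1%:R.
have h0 : 0 <= h by rewrite divr_ge0.
have lh : l = n.+1%:R * h by rewrite mulrC divfK // pnatr_eq0.
have hM : h * `|M| <= (1 - c ^+ 2) * ((1 - c) / 8).
  have n0 : 0 < n.+1%:R :> R by rewrite ltr0n.
  have ln : l * K <= n.+1%:R by rewrite (le_trans (ltW hn)) // ler_nat.
  rewrite /h mulrAC ler_pdivrMr //.
  have -> : l * `|M| = ((1 - c ^+ 2) * ((1 - c) / 8)) * (l * K).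
    by rewrite /K; field; rewrite !gt_eqF // subr_gt0.
  by rewrite ler_wpM2l // mulr_ge0 ?ltW // divr_gt0 // subr_gt0.
rewrite lh; elim: n.+1 => [|k IH].
  apply: (poly_approx_ext _ (@poly_approx_horner R _ 1%:P)) => w _.
  by rewrite hornerC /invsqrt mul0r mul0r subr0 sqrtc1 invr1.
pose m := k%:R * h; rewrite -/m in IH.
have m0 : 0 <= m by rewrite mulr_ge0.
have mE : k.+1%:R * h = m + h by rewrite -natr1 mulrDl mul1r.
rewrite mE.
(* This is h u / (1 - m u), so that 1 - (m + h) u = (1 - m u)(1 - g u). *)
pose g u := h%:C * u * (invsqrt m u * invsqrt m u).
have g8 u : slit_disc c M u -> normc (g u) <= (1 - c) / 8.
  move=> [uM uc]; rewrite /g !normcM -expr2 normc_invsqrt_sqr normc_real.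
  have nge := sector_normc_ge cc m0 uc.
  rewrite ler_pdivrMr ?(lt_le_trans d0) // (ger0_norm h0).
  apply: le_trans (_ : h * `|M| <= _).
    by rewrite ler_wpM2l // (le_trans uM) // ler_norm.
  by rewrite mulrC in hM; rewrite mulrC (le_trans hM) // mulrC ler_wpM2l // divr_ge0 // subr_ge0 ltW.
have bnd u : slit_disc c M u -> normc (invsqrt m u) <= (1 - c ^+ 2)^-1.
  by case=> _ uc; apply: normc_invsqrt_le.
have ag : poly_approx (slit_disc c M) g.
  pose B := `|h * M| + (1 - c ^+ 2)^-1 * (1 - c ^+ 2)^-1.
  have iv0 : 0 <= (1 - c ^+ 2)^-1 by rewrite invr_ge0 ltW.
  have lin : poly_approx (slit_disc c M) (fun u => h%:C * u).
    apply: (poly_approx_ext _ (@poly_approx_horner R _ (h%:C *: 'X))) => u _.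
    by rewrite hornerZ hornerX.
  apply: (poly_approxM (B := B) _ _ lin (poly_approxM bnd bnd IH IH)) => u uM.
    rewrite normcM normc_real (ger0_norm h0) ler_wpDr ?mulr_ge0 //.
    by rewrite (le_trans _ (ler_norm _)) // ler_wpM2l // uM.1.
  by rewrite normcM ler_wpDl // ler_pM ?normc_ge0 // bnd.
have g88 u : slit_disc c M u -> normc (g u) <= 8^-1 by move=> /g8; lra.
have a1 := poly_approx_invsqrt ag g88.
apply: (poly_approx_ext _ (poly_approxM (B := (1 - c ^+ 2)^-1 + 2) _ _ IH a1)).
- move=> u uM; rewrite /invsqrt -invfM; congr (_^-1).
  have vn : 1 - m%:C * u != 0.
    by rewrite -normc_gt0 (lt_le_trans d0) // sector_normc_ge // uM.2.
  rewrite -(@sqrtc_mul_near1 c) ?sector_Re_ge ?g8 //; last exact: uM.2.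
  congr sqrtc; rewrite /g /invsqrt -invfM -expr2 sqr_sqrtc rmorphD /=.
  by field.
- by move=> u /bnd; lra.
move=> u /g88 g8u; have := normc_sqrtc_sub1 (g u).
have := normc_le_dist 1 (sqrtc (1 - g u)); rewrite normc1 normc_distC normcV => h1 h2.
have s0 : 2^-1 <= normc (sqrtc (1 - g u)) by lra.
have : (normc (sqrtc (1 - g u)))^-1 <= 2.
  by rewrite -[2]invrK lef_pV2 ?posrE ?invr_gt0 //; lra.
have : 0 <= (1 - c ^+ 2)^-1 by rewrite invr_ge0 ltW.
lra.
Qed.

End InverseSquareRoot.

(** * The step function *)

Section StepFunction.
Context {R : realType}.
Implicit Types (w z s : R[i]) (a b l C M : R).

(** The quantity [q * r - p * t] is Im s for s = (p + iq) conj(r + it), and Im (s^2) = 2 l b Re w -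
    2 l^2 a b |w|^2. For Re w <= 0 this is negative, so Im s > 0 would force Re s < 0, which the
    signs of the four parts exclude. Between the two rays p q > 0 > r t, hence q >= 0 >= t. *)
Lemma sqrt_quotient_sign a b l w (p q r t : R) :
    0 < a -> 0 < b -> 0 < l -> 0 <= p -> 0 <= r -> w != 0 ->
    (p +i* q) ^+ 2 = 1 - l%:C * ((a -i* b) * w) ->
    (r +i* t) ^+ 2 = 1 - l%:C * ((a +i* b) * w) ->
  (Re w <= 0 -> q * r - p * t <= 0) /\
  (a * `|Im w| < b * Re w -> 0 <= q * r - p * t).
Proof.
case: w => x y a0 b0 l0 p0 r0; rewrite eq_complex /= => w0 [E1 E2] [E3 E4].
have {E1}E1 : p * p - q * q = 1 - l * (a * x + b * y) by move: E1; nra.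
have {E2}E2 : 2 * (p * q) = l * (b * x - a * y) by move: E2; nra.
have {E3}E3 : r * r - t * t = 1 - l * (a * x - b * y) by move: E3; nra.
have {E4}E4 : 2 * (r * t) = - (l * (b * x + a * y)) by move: E4; nra.
split=> [x0|yx].
  rewrite leNgt; apply/negP => H.
  have [D|D] := leP 0 (p * r + q * t).
    have J : 2 * ((q * r - p * t) * (p * r + q * t)) =
        2 * l * b * x - 2 * l ^+ 2 * (a * b) * (x ^+ 2 + y ^+ 2).
      have -> : 2 * ((q * r - p * t) * (p * r + q * t)) =
        2 * (p * q) * (r * r - t * t) + (- (2 * (r * t))) * (p * p - q * q).
        by ring.
      by rewrite E1 E2 E3 E4; ring.
    have : 0 <= (q * r - p * t) * (p * r + q * t) by rewrite mulr_ge0 // ltW.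
    have N : 0 < x ^+ 2 + y ^+ 2.
      rewrite lt_def addr_ge0 ?sqr_ge0 // andbT paddr_eq0 ?sqr_ge0 //.
      by rewrite !sqrf_eq0.
    have : 0 < l ^+ 2 * (a * b) * (x ^+ 2 + y ^+ 2).
      by rewrite !mulr_gt0 // exprn_gt0.
    have : 0 <= l * b * (- x) by rewrite mulr_ge0 ?oppr_ge0 // mulr_ge0 // ltW.
    rewrite mulrN; lra.
  (* Now Re s < 0 with p, r >= 0, so q and t have opposite signs. If q <= 0 then Im s <= 0; if q > 0
     then b Re w >= a |Im w|, which with Re w <= 0 leaves only w = 0. *)
  have pr0 : 0 <= p * r by rewrite mulr_ge0.
  have qt : q * t < 0 by lra.
  have [q0|q0] := leP q 0.
    have t0 : 0 < t by nra.
    have : q * r <= 0 by nra.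
    have : 0 <= p * t by rewrite mulr_ge0 // ltW.
    lra.
  have t0 : t < 0 by nra.
  have pq : 0 <= p * q by rewrite mulr_ge0 // ltW.
  have rt : r * t <= 0 by nra.
  have c1 : 0 <= b * x - a * y by rewrite -(pmulr_rge0 _ l0) -E2; lra.
  have c2 : 0 <= b * x + a * y by rewrite -(pmulr_rge0 _ l0); lra.
  have xe : x = 0 by apply/eqP; rewrite eq_le x0 -(pmulr_rge0 _ b0); lra.
  have ye : y = 0.
    apply/eqP; rewrite eq_le -(pmulr_rge0 y a0) -oppr_ge0 -(pmulr_rge0 (- y) a0).
    by rewrite xe in c1 c2; apply/andP; split; lra.
  by rewrite xe ye eqxx in w0.
have y1 : a * y <= a * `|y| by rewrite ler_wpM2l ?ler_norm // ltW.
have y2 : a * (- y) <= a * `|y| by rewrite -normrN ler_wpM2l ?ler_norm // ltW.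
have pq : 0 <= p * q.
  by have : 0 <= l * (b * x - a * y); [rewrite mulr_ge0; lra | lra].
have rt : r * t <= 0.
  by have : 0 <= l * (b * x + a * y); [rewrite mulr_ge0; lra | lra].
have pqgt : 0 < p * q.
  by have : 0 < l * (b * x - a * y); [rewrite mulr_gt0; lra | lra].
have rtlt : r * t < 0.
  by have : 0 < l * (b * x + a * y); [rewrite mulr_gt0; lra | lra].
have q0 : 0 <= q by nra.
have t0 : t <= 0 by nra.
nra.
Qed.

Lemma Re_divc z s : s != 0 ->
  Re (z / s) * normc s ^+ 2 = Re z * Re s + Im z * Im s.
Proof.
move=> s0; have n0 : normc s ^+ 2 != 0 by rewrite expf_neq0 // gt_eqF // normc_gt0.
rewrite normc_sqr in n0 *; rewrite Re_mulc; case: z s s0 n0 => [x y] [u v] _ /= n0.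
by field.
Qed.

(* For the unit vector [a + ib], this approximates the sign of [Re w] off the
   two rays spanned by [a + ib] and [a - ib], when [l] is large. *)
Definition soft_sign a b l w : R[i] :=
  l%:C * w * (invsqrt l ((a -i* b) * w) * invsqrt l ((a +i* b) * w)).

(** Since sa^2 - sb^2 = 2 i b l w, the soft sign is (sa / sb - sb / sa) / (2 i b). Its real part is
    a positive multiple of Im (sa conj(sb)), whose sign is given by [sqrt_quotient_sign]. *)
Lemma soft_sign_Re a b l w (sa := sqrtc (1 - l%:C * ((a -i* b) * w)))
    (sb := sqrtc (1 - l%:C * ((a +i* b) * w))) :
    0 < a -> 0 < b -> 0 < l -> sa != 0 -> sb != 0 ->
  (Re w <= 0 -> Re (soft_sign a b l w) <= 0) /\
  (a * `|Im w| < b * Re w -> 0 <= Re (soft_sign a b l w)).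
Proof.
move=> a0 b0 l0 sa0 sb0.
have [w0|w0] := eqVneq w 0.
  by rewrite /soft_sign w0 !(mulr0, mul0r) /= !lexx.
have s0 : sa * sb != 0 by rewrite mulf_neq0.
have n0 : 0 < normc (sa * sb) ^+ 2 by rewrite exprn_gt0 // normc_gt0.
have E : soft_sign a b l w = l%:C * w / (sa * sb).
  by rewrite /soft_sign /invsqrt -invfM.
move: n0 (Re_divc (l%:C * w) s0); rewrite -E; move: (normc _ ^+ 2) => N n0.
have := sqr_sqrtc (1 - l%:C * ((a -i* b) * w)).
have := sqr_sqrtc (1 - l%:C * ((a +i* b) * w)).
have := Re_sqrtc_ge0 (1 - l%:C * ((a -i* b) * w)).
have := Re_sqrtc_ge0 (1 - l%:C * ((a +i* b) * w)).
rewrite -/sa -/sb; case: (sa) (sb) => [p q] [r t] /= r0 p0 sbE saE H.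
have [S1 S2] := sqrt_quotient_sign a0 b0 l0 p0 r0 w0 saE sbE.
have K : Re (soft_sign a b l w) * N * (2 * b) =
    (p * p + q * q + (r * r + t * t)) * (q * r - p * t).
  rewrite H; move: saE sbE; case: (w) => x y /= [F1 F2] [G1 G2].
  have {}F1 : p * p - q * q = 1 - l * (a * x + b * y) by move: F1; nra.
  have {}F2 : 2 * (p * q) = l * (b * x - a * y) by move: F2; nra.
  have {}G1 : r * r - t * t = 1 - l * (a * x - b * y) by move: G1; nra.
  have {}G2 : 2 * (r * t) = - (l * (b * x + a * y)) by move: G2; nra.
  have ly : 2 * b * (l * y) = (r * r - t * t) - (p * p - q * q) by rewrite F1 G1; ring.
  have lx : 2 * b * (l * x) = 2 * (p * q) - 2 * (r * t) by rewrite F2 G2; ring.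
  rewrite !mul0r subr0 addr0.
  transitivity (2 * b * (l * x) * (p * r - q * t) + 2 * b * (l * y) * (p * t + q * r)).
    by ring.
  by rewrite lx ly; ring.
have P : 0 <= p * p + q * q + (r * r + t * t).
  by rewrite -!expr2 !addr_ge0 ?sqr_ge0.
have bn : 0 < N * (2 * b) by rewrite mulr_gt0 // mulr_gt0.
split=> [/S1 S|/S2 S].
  by rewrite -(pmulr_lle0 _ bn) mulrA K mulr_ge0_le0.
by rewrite -(pmulr_lge0 _ bn) mulrA K mulr_ge0.
Qed.

(** This turns closeness of a square to 1 into closeness to 1, given the sign of the real part: the
    other factor z + 1 has modulus at least 1. *)
Lemma normc_sub1_le z : 0 <= Re z -> normc (z - 1) <= normc (z ^+ 2 - 1).
Proof.
move=> z0; have -> : z ^+ 2 - 1 = (z - 1) * (z + 1) by ring.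
rewrite normcM ler_peMr ?normc_ge0 //; apply: le_trans (Re_le_normc _).
by rewrite Re_addc /=; lra.
Qed.

Section Bounds.
Variables (a b c : R).
Hypotheses (a0 : 0 < a) (b0 : 0 < b) (ab1 : a ^+ 2 + b ^+ 2 = 1).
Hypothesis c01 : 0 <= c < 1.

(** Multiplication by a - ib turns the ray of a + ib onto the positive axis. So w avoids the open
    sectors of half-angle arccos c about the rays of a + ib and a - ib. *)
Definition off_rays w : Prop :=
  Re ((a -i* b) * w) <= c * normc w /\ Re ((a +i* b) * w) <= c * normc w.

Lemma normc_ray1 w : normc ((a -i* b) * w) = normc w.
Proof. by rewrite normcM /= sqrrN ab1 sqrtr1 mul1r. Qed.

Lemma normc_ray2 w : normc ((a +i* b) * w) = normc w.
Proof. by rewrite normcM /= ab1 sqrtr1 mul1r. Qed.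

(** As a^2 + b^2 = 1, the product va vb of the two radicands is 1 - 2 a l w + (l w)^2, so the
    squared soft sign differs from 1 by (2 a l w - 1) / (va vb). The bound |va vb| >= k (l |w|)^2
    then yields the first and the last estimate. *)
Lemma soft_sign_facts l w (k := 1 - c ^+ 2) : 0 < l -> off_rays w ->
  [/\ normc (soft_sign a b l w) <= k^-1,
      Re w <= 0 -> Re (soft_sign a b l w) <= 0,
      a * `|Im w| < b * Re w -> 0 <= Re (soft_sign a b l w) &
      w != 0 -> normc (soft_sign a b l w ^+ 2 - 1)
        <= (2 * (l * normc w) + 1) / (k * (l * normc w) ^+ 2)].
Proof.
move=> l0 [w1 w2]; have k0 : 0 < k by rewrite /k; move/andP: c01 => [? ?]; nra.
have k1 : k <= 1 by rewrite /k; move/andP: c01 => [? ?]; nra.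
rewrite -normc_ray1 in w1; rewrite -normc_ray2 in w2.
have [d1 e1] := sector_dist_ge c01 (ltW l0) w1.
have [d2 e2] := sector_dist_ge c01 (ltW l0) w2.
rewrite normc_ray1 in e1; rewrite normc_ray2 in e2.
rewrite -/k in d1 e1 d2 e2.
set va := 1 - l%:C * ((a -i* b) * w) in d1 e1.
set vb := 1 - l%:C * ((a +i* b) * w) in d2 e2.
have va0 : va != 0 by rewrite -normc_gt0; have := normc_ge0 va; nra.
have vb0 : vb != 0 by rewrite -normc_gt0; have := normc_ge0 vb; nra.
have sa0 : sqrtc va != 0 by rewrite sqrtc_eq0.
have sb0 : sqrtc vb != 0 by rewrite sqrtc_eq0.
have [S1 S2] := soft_sign_Re a0 b0 l0 sa0 sb0.
have Esq : soft_sign a b l w ^+ 2 = (l%:C * w) ^+ 2 / (va * vb).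
  by rewrite /soft_sign /invsqrt -/va -/vb !exprMn !exprVn !sqr_sqrtc -invfM.
have nv0 : 0 < normc va * normc vb by rewrite mulr_gt0 ?normc_gt0.
have low : k * (l * normc w) ^+ 2 <= normc va * normc vb.
  have T0 := sqr_ge0 (l * normc w).
  have kT : 0 <= k * (l * normc w) ^+ 2 by rewrite mulr_ge0 // ltW.
  rewrite -(@ler_pXn2r _ 2) ?nnegrE ?(ltW nv0) // [leRHS]exprMn.
  apply: le_trans (_ : k * (l * normc w) ^+ 2 * (k * (l * normc w) ^+ 2) <= _).
    by rewrite expr2.
  exact: ler_pM.
have lw : normc (l%:C * w) = l * normc w by rewrite normcM normc_real gtr0_norm.
split=> //.
  have : normc (soft_sign a b l w) ^+ 2 <= k^-1.
    rewrite -normcX Esq normcM normcX lw normcV normcM ler_pdivrMr //.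
    by rewrite ler_pdivlMl.
  have ki : 1 <= k^-1 by rewrite invf_ge1.
  have := normc_ge0 (soft_sign a b l w).
  move: (normc _) (k^-1) ki => A B *; nra.
move=> w0; have lw0 : 0 < l * normc w by rewrite mulr_gt0 ?normc_gt0.
have -> : soft_sign a b l w ^+ 2 - 1 = ((2 * a)%:C * (l%:C * w) - 1) / (va * vb).
  rewrite Esq -[X in _ - X](divff (mulf_neq0 va0 vb0)) -mulrBl; congr (_ / _).
  rewrite /va /vb; have -> : (a -i* b : R[i]) = a%:C - 'i%C * b%:C.
    by apply/eqP; rewrite eq_complex /=; apply/andP; split; apply/eqP; ring.
  have -> : (a +i* b : R[i]) = a%:C + 'i%C * b%:C.
    by apply/eqP; rewrite eq_complex /=; apply/andP; split; apply/eqP; ring.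
  have N1 : a%:C ^+ 2 + b%:C ^+ 2 = 1 :> R[i] by rewrite -!rmorphXn -rmorphD /= ab1.
  have N2 := sqr_i R; rewrite rmorphM /= rmorph_nat.
  have -> : (1 - l%:C * ((a%:C - 'i * b%:C) * w)) * (1 - l%:C * ((a%:C + 'i * b%:C) * w))
     = 1 - 2 * a%:C * (l%:C * w) + (l%:C * w) ^+ 2 * (a%:C ^+ 2 - 'i ^+ 2 * b%:C ^+ 2).
    by ring.
  by rewrite N2 mulN1r opprK N1; ring.
rewrite normcM normcV normcM; apply: ler_pM; rewrite ?normc_ge0 ?invr_ge0 ?(ltW nv0) //.
  apply: le_trans (normcB_le _ _) _; rewrite normcM normc_real normc1 lw lerD2r.
  have a1 : a <= 1 by rewrite -(@ler_pXn2r _ 2) ?nnegrE ?(ltW a0) // expr1n -[leRHS]ab1 lerDl sqr_ge0.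
  by rewrite ler_wpM2r ?(ltW lw0) // gtr0_norm ?mulr_gt0 // ler_piMr.
by rewrite lef_pV2 ?posrE // mulr_gt0 // exprn_gt0.
Qed.

Lemma poly_approx_soft_sign l M : 0 < l ->
  poly_approx [set w | normc w <= M /\ off_rays w] (soft_sign a b l).
Proof.
move=> l0; have k0 : 0 < 1 - c ^+ 2 by move/andP: c01 => [? ?]; nra.
set Y := [set _ | _]; pose k := (1 - c ^+ 2)^-1.
have kk : 0 <= k by rewrite invr_ge0 ltW.
have A := poly_approx_invsqrt_slit M c01 (ltW l0).
have A1 : poly_approx Y (fun w => invsqrt l ((a -i* b) * w)).
  by apply: poly_approx_scale A => w [wM [w1 w2]]; split; rewrite normc_ray1.
have A2 : poly_approx Y (fun w => invsqrt l ((a +i* b) * w)).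
  by apply: poly_approx_scale A => w [wM [w1 w2]]; split; rewrite normc_ray2.
have B1 w : Y w -> normc (invsqrt l ((a -i* b) * w)) <= k.
  by move=> [wM [w1 w2]]; apply: normc_invsqrt_le (ltW l0) _ => //; rewrite normc_ray1.
have B2 w : Y w -> normc (invsqrt l ((a +i* b) * w)) <= k.
  by move=> [wM [w1 w2]]; apply: normc_invsqrt_le (ltW l0) _ => //; rewrite normc_ray2.
have lin : poly_approx Y (fun u => l%:C * u).
  apply: (poly_approx_ext _ (@poly_approx_horner R _ (l%:C *: 'X))) => u _.
  by rewrite hornerZ hornerX.
apply: (poly_approxM (B := `|l * M| + k * k) _ _ lin (poly_approxM B1 B2 A1 A2)) => w Yw.
  rewrite normcM normc_real (gtr0_norm l0) ler_wpDr ?mulr_ge0 //.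
  by rewrite (le_trans _ (ler_norm _)) // ler_wpM2l ?(ltW l0) // Yw.1.
by rewrite normcM ler_wpDl // ler_pM ?normc_ge0 // ?B1 ?B2.
Qed.

End Bounds.

(** The polynomial is (1 + q) / 2 with q close to a soft sign, which is near -1 on the half-plane
    and near 1 on the sector away from 0. Its rays lie in the two gaps between these sets. *)
Lemma sector_step C M : 0 <= C -> exists B : R, forall e, 0 < e ->
  exists p : {poly R[i]}, forall w, normc w <= M ->
    [/\ Re w <= 0 \/ normc w <= C * Re w -> normc p.[w] <= B /\ normc (1 - p.[w]) <= B,
        Re w <= 0 -> e <= normc w -> normc p.[w] <= e &
        normc w <= C * Re w -> e <= normc w -> normc (1 - p.[w]) <= e].
Proof.
(* The sector has slope at most D; the unit vector a + ib is given slope D + 1. *)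
move=> C0; pose D := C + 1; pose n := Num.sqrt (1 + (D + 1) ^+ 2).
have D1 : 1 <= D by rewrite /D; lra.
have n2 : n ^+ 2 = 1 + (D + 1) ^+ 2 by rewrite sqr_sqrtr // addr_ge0 // sqr_ge0.
have n0 : 0 < n by rewrite sqrtr_gt0; have := sqr_ge0 (D + 1); lra.
pose a := n^-1; pose b := (D + 1) / n.
have a0 : 0 < a by rewrite invr_gt0.
have b0 : 0 < b by rewrite divr_gt0 //; lra.
have ab1 : a ^+ 2 + b ^+ 2 = 1.
  by rewrite /a /b expr_div_n exprVn -[X in X + _]mul1r -mulrDl -n2 divff // expf_neq0 // gt_eqF.
have bD : b = D * a + a by rewrite /a /b mulrDl mul1r.
(* In the sector b Re w - a |Im w| >= (a / D) |w|. As the squares of b Re w - a |Im w| and a Re w +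
   b |Im w| add up to |w|^2, the latter is at most c |w|. For Re w <= 0, c >= b suffices. *)
pose c := Num.sqrt (1 - (a / D) ^+ 2).
have aD0 : 0 < a / D by rewrite divr_gt0 //; lra.
have aDa : a / D <= a by rewrite ler_pdivrMr; [nra | lra].
have aa : (a / D) ^+ 2 <= a ^+ 2 by rewrite lerXn2r // nnegrE ltW.
have c2 : c ^+ 2 = 1 - (a / D) ^+ 2.
  by rewrite sqr_sqrtr // subr_ge0 (le_trans aa) //; have := sqr_ge0 b; lra.
have aD2 : 0 < (a / D) ^+ 2 by rewrite exprn_gt0.
have c0 : 0 <= c by apply: sqrtr_ge0.
have c01 : 0 <= c < 1 by rewrite c0 /=; nra.
have bc : b <= c.
  by rewrite -(@ler_pXn2r _ 2) ?nnegrE ?(ltW b0) // c2; lra.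
have ray1E w : Re ((a -i* b) * w) = a * Re w + b * Im w by rewrite Re_mulc /=; ring.
have ray2E w : Re ((a +i* b) * w) = a * Re w - b * Im w by rewrite Re_mulc.
have Im1 w : `|Im w| <= normc w.
  rewrite -(@ler_pXn2r _ 2) ?nnegrE ?normc_ge0 // real_normK ?num_real // normc_sqr.
  by rewrite lerDr sqr_ge0.
have CD w : normc w <= C * Re w -> normc w <= D * Re w /\ 0 <= Re w.
  move=> H; have h0 := normc_ge0 w; have h1 := Re_le_normc w.
  have x0 : 0 <= Re w by rewrite leNgt; apply/negP => ?; have := geN_normc_Re w; nra.
  by split=> //; rewrite /D; nra.
have gap w : normc w <= D * Re w -> 0 <= Re w -> a * `|Im w| <= b * Re w - a / D * normc w.
  move=> H x0; have h1 := Im1 w.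
  have : a / D * normc w <= a * Re w.
    by rewrite -mulrA ler_pM2l // ler_pdivrMl //; lra.
  have : a * `|Im w| <= a * (D * Re w) by rewrite ler_pM2l //; lra.
  by rewrite bD; lra.
have off w : Re w <= 0 \/ normc w <= C * Re w -> off_rays a b c w.
  have y1 := ler_norm (Im w); have y2 := ler_norm (- Im w); rewrite normrN in y2.
  suff H : Re w <= 0 \/ normc w <= C * Re w -> a * Re w + b * `|Im w| <= c * normc w.
    move=> /H h; rewrite /off_rays ray1E ray2E.
    have : b * Im w <= b * `|Im w| by rewrite ler_pM2l.
    have : b * - Im w <= b * `|Im w| by rewrite ler_pM2l.
    by rewrite mulrN; split; lra.
  case=> [x0|/CD[h x0]].
    have : b * `|Im w| <= c * normc w by apply: ler_pM => //; apply: ltW.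
    have : a * Re w <= 0 by rewrite pmulr_rle0.
    by lra.
  have g := gap w h x0.
  rewrite -(@ler_pXn2r _ 2) ?nnegrE ?mulr_ge0 ?normc_ge0 //; last first.
    by rewrite addr_ge0 // mulr_ge0 // ltW.
  rewrite exprMn c2.
  have N : normc w ^+ 2 = Re w ^+ 2 + `|Im w| ^+ 2.
    by rewrite normc_sqr real_normK ?num_real.
  have L : (a / D * normc w) ^+ 2 <= (b * Re w - a * `|Im w|) ^+ 2.
    have p0 : 0 <= a / D * normc w by rewrite mulr_ge0 ?normc_ge0 // ltW.
    by rewrite lerXn2r ?nnegrE //; lra.
  have -> : (1 - (a / D) ^+ 2) * normc w ^+ 2 = normc w ^+ 2 - (a / D * normc w) ^+ 2.
    by rewrite exprMn; ring.
  have -> : (a * Re w + b * `|Im w|) ^+ 2 =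
      (a ^+ 2 + b ^+ 2) * (Re w ^+ 2 + `|Im w| ^+ 2) - (b * Re w - a * `|Im w|) ^+ 2.
    by ring.
  by rewrite ab1 N mul1r; lra.
pose k := 1 - c ^+ 2; have k0 : 0 < k by rewrite /k c2; lra.
exists (2 + k^-1) => e e0.
(* For |w| >= e, t = l |w| satisfies t >= 1 and t k e >= 6, whence 2 t + 1 <= 6 t <= e k t^2. *)
pose l := (1 + 6 / (k * e)) / e.
have ke0 : 0 < k * e by rewrite mulr_gt0.
have l0 : 0 < l by rewrite !divr_gt0 // addr_gt0 // divr_gt0.
pose d := Num.min 1 (e / 2).
have d0 : 0 < d by rewrite lt_min ltr01 divr_gt0.
have d1 : d <= 1 by rewrite ge_min lexx.
have de : d <= e / 2 by rewrite ge_min lexx orbT.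
have [q hq] := poly_approx_soft_sign ab1 c01 M l0 d0.
exists (2^-1 *: (1 + q)) => w wM.
pose E := soft_sign a b l w.
have pE : (2^-1 *: (1 + q)).[w] = 2^-1 * (1 + q.[w]).
  by rewrite hornerZ hornerD -polyC1 hornerC.
have qpE : 1 - (2^-1 *: (1 + q)).[w] = 2^-1 * (1 - q.[w]).
  by rewrite pE -[X in X - _]half2; ring.
have small : w != 0 -> off_rays a b c w -> e <= normc w -> normc (E ^+ 2 - 1) <= e.
  move=> w0 /(soft_sign_facts a0 b0 ab1 c01 l0)[_ _ _ /(_ w0) H] ew.
  apply: le_trans H _; rewrite -/k.
  have T : 1 + 6 / (k * e) <= l * normc w.
    apply: le_trans (_ : l * e <= _); last by rewrite ler_pM2l.
    by rewrite /l divfK // gt_eqF.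
  have s0 : 0 < 6 / (k * e) by rewrite divr_gt0.
  have kT : 6 <= l * normc w * (k * e) by rewrite -ler_pdivrMr //; lra.
  move: T kT; move: (l * normc w) => t T kT.
  have t0 : 0 < t by lra.
  rewrite ler_pdivrMr ?mulr_gt0 ?exprn_gt0 //.
  have -> : e * (k * t ^+ 2) = t * (t * (k * e)) by ring.
  have : t * 6 <= t * (t * (k * e)) by rewrite ler_wpM2l //; lra.
  by lra.
have wn0 : e <= normc w -> w != 0 by move=> ?; rewrite -normc_gt0 (lt_le_trans e0).
split=> [Yw|x0 ew|xC ew].
- have ow := off w Yw; have [Eb _ _ _] := soft_sign_facts a0 b0 ab1 c01 l0 ow.
  have qw : normc (q.[w] - E) <= d by apply: hq; split.
  have qb : normc q.[w] <= 1 + k^-1.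
    by have := normc_le_dist q.[w] E; rewrite -/E -/k in Eb; lra.
  rewrite qpE pE !normcM normc_half.
  have := le_normcD 1 q.[w]; have := normcB_le 1 q.[w]; rewrite normc1.
  have := invr_ge0 k; rewrite (ltW k0) => ?; split; lra.
- have ow := off w (or_introl x0); have [_ /(_ x0) Es _ _] := soft_sign_facts a0 b0 ab1 c01 l0 ow.
  have qw : normc (q.[w] - E) <= d by apply: hq; split.
  have := small (wn0 ew) ow ew; rewrite pE normcM normc_half.
  have := normc_sub1_le (z := - E); rewrite Re_oppc oppr_ge0 => /(_ Es); rewrite sqrrN.
  have -> : 1 + q.[w] = (q.[w] - E) - (- E - 1) by ring.
  have := normcB_le (q.[w] - E) (- E - 1); lra.
- have ow := off w (or_intror xC); have [h x0] := CD w xC.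
  have Es : 0 <= Re E.
    have [_ _ + _] := soft_sign_facts a0 b0 ab1 c01 l0 ow; apply.
    apply: le_lt_trans (gap w h x0) _; rewrite gtrBl mulr_gt0 // normc_gt0; exact: wn0.
  have qw : normc (q.[w] - E) <= d by apply: hq; split.
  have := small (wn0 ew) ow ew; rewrite qpE normcM normc_half.
  have := normc_sub1_le Es.
  have -> : 1 - q.[w] = - (q.[w] - E) - (E - 1) by ring.
  have := normcB_le (- (q.[w] - E)) (E - 1); rewrite normcN; lra.
Qed.

End StepFunction.

(** * Polynomial hulls and Kallin's lemma *)

Section Hull.
Context {R : realType} {n : nat}.
Implicit Types (K : set 'cV[R[i]]_n) (z w : 'cV[R[i]]_n) (f : {mpoly R[i][n]}) (r : R).

Lemma euclidean_norm_ge0 z : 0 <= euclidean_norm z.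
Proof. exact: sqrtr_ge0. Qed.

Lemma euclidean_norm0 : euclidean_norm (0 : 'cV[R[i]]_n) = 0.
Proof.
rewrite /euclidean_norm big1 ?sqrtr0 // => i _.
by rewrite mxE -[X in normc X]/(0 : R[i]) normc0 expr0n.
Qed.

Lemma euclidean_norm_sqr z : euclidean_norm z ^+ 2 = \sum_(i < n) normc (z i ord0) ^+ 2.
Proof. by rewrite sqr_sqrtr // sumr_ge0 // => i _; rewrite sqr_ge0. Qed.

Lemma normc_coord_le z i : normc (z i ord0) <= euclidean_norm z.
Proof.
rewrite -(@ler_pXn2r _ 2) ?nnegrE ?normc_ge0 ?euclidean_norm_ge0 //.
rewrite euclidean_norm_sqr (bigD1 i) //= lerDl sumr_ge0 // => j _.
exact: sqr_ge0.
Qed.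

(** The point w0 makes the set of values nonempty, so that [sup] is at most every upper bound. *)
Lemma poly_hull_le K f z w0 B : K w0 -> poly_hull K z ->
  (forall w, K w -> normc (poly_val f w) <= B) -> normc (poly_val f z) <= B.
Proof.
move=> K0 /(_ f) Hz HB; apply: le_trans Hz _; apply: ge_sup.
  by exists (normc (poly_val f w0)), w0.
by move=> _ [w Kw <-]; apply: HB.
Qed.

(** Constants and coordinates have this property, and sums and products inherit it. *)
Lemma poly_val_lipschitz f r : 0 <= r -> exists2 L : R, 0 <= L &
  forall z, euclidean_norm z <= r ->
    normc (poly_val f z - poly_val f 0) <= L * euclidean_norm z.
Proof.
move=> r0; pose P (g : {mpoly R[i][n]}) := exists2 L : R, 0 <= L &
  forall z, euclidean_norm z <= r ->
    normc (poly_val g z - poly_val g 0) <= L * euclidean_norm z.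
have PC (c : R[i]) : P c%:MP.
  by exists 0 => // z _; rewrite /poly_val !mevalC subrr normc0 mul0r.
have PX i : P 'X_i.
  by exists 1 => // z _; rewrite /poly_val !mevalXU mxE subr0 mul1r normc_coord_le.
have PD g h : P g -> P h -> P (g + h).
  move=> [L L0 HL] [N N0 HN]; exists (L + N); first exact: addr_ge0.
  move=> z zr; rewrite /poly_val !mevalD opprD addrACA mulrDl.
  by apply: le_trans (le_normcD _ _) (lerD (HL _ zr) (HN _ zr)).
have PM g h : P g -> P h -> P (g * h).
  move=> [L L0 HL] [N N0 HN].
  exists (L * (N * r + normc (poly_val h 0)) + normc (poly_val g 0) * N).
    by rewrite addr_ge0 ?mulr_ge0 ?addr_ge0 ?normc_ge0 ?mulr_ge0.
  move=> z zr; have := HL _ zr; have := HN _ zr; rewrite /poly_val !mevalM -/(poly_val g z) -/(poly_val h z).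
  rewrite -/(poly_val g 0) -/(poly_val h 0).
  move: (poly_val g z) (poly_val h z) (poly_val g 0) (poly_val h 0) => gz hz g0 h0.
  move=> Hh Hg; have -> : gz * hz - g0 * h0 = (gz - g0) * hz + g0 * (hz - h0) by ring.
  apply: le_trans (le_normcD _ _) _; rewrite !normcM.
  have e0 := euclidean_norm_ge0 z.
  have hb : normc hz <= N * r + normc h0.
    have := normc_le_dist hz h0; have : N * euclidean_norm z <= N * r by rewrite ler_wpM2l.
    lra.
  have := ler_pM (normc_ge0 _) (normc_ge0 _) Hg hb.
  have := ler_wpM2l (normc_ge0 g0) Hh.
  lra.
suff : P f by [].
elim/mpolyind: f => [|c m p _ _ Pp]; first by rewrite -mpolyC0; apply: PC.
apply: (PD _ _ _ Pp); rewrite -mul_mpolyC; apply: (PM) => //.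
rewrite mpolyXE_id; elim/big_rec: _ => [|i q _ Pq]; first by rewrite -mpolyC1; apply: PC.
apply: (PM _ _ _ Pq); elim: (m i) => [|k IH]; first by rewrite expr0 -mpolyC1; apply: PC.
by rewrite exprS; apply: (PM _ _ _ IH).
Qed.

Lemma poly_val_bounded f r : 0 <= r -> exists2 M : R, 0 <= M &
  forall z, euclidean_norm z <= r -> normc (poly_val f z) <= M.
Proof.
move=> r0; have [L L0 HL] := poly_val_lipschitz f r0.
exists (L * r + normc (poly_val f 0)); first by rewrite addr_ge0 ?normc_ge0 ?mulr_ge0.
move=> z zr; have := HL _ zr; have := normc_le_dist (poly_val f z) (poly_val f 0).
by have := ler_wpM2l L0 zr; lra.
Qed.

(** Boundedness makes [sup] a genuine supremum for every polynomial. *)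
Lemma subset_poly_hull K : (exists2 r, 0 <= r & K `<=` [set z | euclidean_norm z <= r]) ->
  K `<=` poly_hull K.
Proof.
move=> [r r0 Kr] z Kz f; have [M M0 HM] := poly_val_bounded f r0.
apply: ub_le_sup; last by exists z.
by exists M => _ [w Kw <-]; apply: HM; apply: Kr.
Qed.

Lemma closed_ball0E r : closed_euclidean_ball 0 r = [set z | euclidean_norm z <= r] :> set 'cV[R[i]]_n.
Proof. by rewrite /closed_euclidean_ball; apply/seteqP; split=> z /=; rewrite subr0. Qed.

Definition mpoly_comp (p : {poly R[i]}) f : {mpoly R[i][n]} := (map_poly (@mpolyC n R[i]) p).[f].

Lemma poly_val_comp p f z : poly_val (mpoly_comp p f) z = p.[poly_val f z].
Proof.
rewrite /poly_val /mpoly_comp; elim/poly_ind: p => [|p c IH].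
  by rewrite map_poly0 !horner0 meval0.
by rewrite rmorphD rmorphM /= map_polyX map_polyC !hornerMXaddC mevalD mevalM mevalC IH.
Qed.

End Hull.

Section Kallin.
Context {R : realType} {n : nat}.
Implicit Types (K E : set 'cV[R[i]]_n) (z w : 'cV[R[i]]_n) (f psi : {mpoly R[i][n]}) (r : R).

Lemma poly_hullPn K z w0 r : K w0 -> 0 <= r -> K `<=` [set w | euclidean_norm w <= r] ->
  ~ poly_hull K z -> exists f (d : R),
    [/\ poly_val f z = 1, 0 <= d < 1 & forall w, K w -> normc (poly_val f w) <= d].
Proof.
move=> K0 r0 Kr /existsNP[g /negP]; rewrite -ltNge; set s := sup _ => sg.
have gs w : K w -> normc (poly_val g w) <= s.
  have [M M0 HM] := poly_val_bounded g r0.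
  move=> Kw; apply: ub_le_sup; last by exists w.
  by exists M => _ [v Kv <-]; apply: HM; apply: Kr.
have s0 : 0 <= s := le_trans (normc_ge0 _) (gs _ K0).
have g0 : 0 < normc (poly_val g z) := le_lt_trans s0 sg.
exists ((poly_val g z)^-1 *: g), (s / normc (poly_val g z)); split.
- by rewrite /poly_val mevalZ mulVf // -normc_gt0.
- by rewrite divr_ge0 ?normc_ge0 //= ltr_pdivrMr // mul1r.
- move=> w /gs gw; rewrite /poly_val mevalZ normcM normcV mulrC.
  by rewrite ler_wpM2r ?invr_ge0 ?normc_ge0.
Qed.

(** Take f with f(z) = 1 and |f| <= d < 1 on K1, and test the hull at z with F = f^N p(psi). On K1
    and near 0, a large power N beats the bound B on p(psi). Elsewhere on K, |psi| is bounded below,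
    so p(psi) is small enough to beat f^N. Hence |F| <= 1/4 on K, while F(z) = p(psi(z)). *)
Lemma peak_bound K1 K z psi r (k B : R) : 0 <= r ->
    K `<=` [set w | euclidean_norm w <= r] -> K1 `<=` K -> K1 0 ->
    poly_hull K z -> ~ poly_hull K1 z -> 0 < k ->
    (forall w, K w -> ~ K1 w -> k * euclidean_norm w ^+ 2 <= normc (poly_val psi w)) ->
  exists2 e : R, 0 < e & forall p : {poly R[i]},
    (forall w, K w -> normc p.[poly_val psi w] <= B) ->
    (forall w, K w -> ~ K1 w -> e <= normc (poly_val psi w) ->
       normc p.[poly_val psi w] <= e) ->
    normc p.[poly_val psi z] < 2^-1.
Proof.
move=> r0 Kr K1K K10 Kz nK1z k0 psik.
have [f [d [fz /andP[d0 d1] fd]]] := poly_hullPn K10 r0 (subset_trans K1K Kr) nK1z.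
have [L L0 HL] := poly_val_lipschitz f r0.
have [M M0 HM] := poly_val_bounded f r0.
pose d' := (1 + d) / 2; have d'0 : 0 <= d' by rewrite /d'; lra.
have d'1 : d' < 1 by rewrite /d'; lra.
(* Within distance rho of 0, f differs from f(0) by at most (1 - d) / 2, so |f| <= d'. *)
pose rho := (1 - d) / (2 * (L + 1)).
have rho0 : 0 < rho by rewrite divr_gt0 //; lra.
have Lrho : L * rho <= (1 - d) / 2.
  have -> : (1 - d) / 2 = (L + 1) * rho by rewrite /rho; field; rewrite gt_eqF //; lra.
  by rewrite ler_wpM2r ?ltW //; lra.
have B1 : 0 < `|B| + 1 by have := normr_ge0 B; lra.
have [N hN] : exists N, d' ^+ N < (4 * (`|B| + 1))^-1.
  by apply: geom_small => //; rewrite invr_gt0 mulr_gt0.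
have MN : 0 < M ^+ N + 1 by have := exprn_ge0 N M0; lra.
(* The first bound ensures |psi| >= e off K1 beyond radius rho; the second makes M^N e at most
   1/4. *)
pose e := Num.min (k * rho ^+ 2) (4 * (M ^+ N + 1))^-1.
have e0 : 0 < e.
  by rewrite lt_min mulr_gt0 ?exprn_gt0 //= invr_gt0 mulr_gt0.
have e1 : e <= k * rho ^+ 2 by rewrite ge_min lexx.
have e2 : e <= (4 * (M ^+ N + 1))^-1 by rewrite ge_min lexx orbT.
exists e => // p pB pe.
pose F := f ^+ N * mpoly_comp p psi.
have FE w : poly_val F w = poly_val f w ^+ N * p.[poly_val psi w].
  by rewrite -poly_val_comp /F /poly_val mevalM rmorphXn.
have small w : K w -> normc (poly_val f w) <= d' -> normc (poly_val F w) <= 4^-1.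
  move=> Kw fw; rewrite FE normcM normcX.
  apply: le_trans (_ : d' ^+ N * (`|B| + 1) <= _).
    apply: ler_pM; rewrite ?exprn_ge0 ?normc_ge0 //.
      by rewrite lerXn2r // nnegrE normc_ge0.
    by have := pB w Kw; have := ler_norm B; lra.
  rewrite -ler_pdivlMr //; apply: le_trans (ltW hN) _.
  by rewrite invfM.
have FK w : K w -> normc (poly_val F w) <= 4^-1.
  move=> Kw; have [K1w|nK1w] := pselect (K1 w).
    by apply: small => //; apply: le_trans (fd _ K1w) _; rewrite /d'; lra.
  have [wr|wr] := leP (euclidean_norm w) rho.
    apply: small => //; have := HL w (Kr _ Kw); have := fd _ K10.
    have := normc_le_dist (poly_val f w) (poly_val f 0).
    have : L * euclidean_norm w <= L * rho by rewrite ler_wpM2l.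
    by rewrite /d'; lra.
  have ew : e <= normc (poly_val psi w).
    apply: le_trans (psik w Kw nK1w); apply: le_trans e1 _.
    by rewrite ler_pM2l // lerXn2r ?nnegrE ?euclidean_norm_ge0 // ltW.
  have pw := pe w Kw nK1w ew.
  rewrite FE normcM normcX; apply: le_trans (_ : (M ^+ N + 1) * e <= _).
    apply: ler_pM; rewrite ?exprn_ge0 ?normc_ge0 //.
    apply: le_trans (_ : M ^+ N <= _); last by lra.
    by rewrite lerXn2r ?nnegrE ?normc_ge0 // HM //; apply: Kr.
  by rewrite -ler_pdivlMl // -invfM [_ * 4]mulrC.
have := poly_hull_le (K1K _ K10) Kz FK; rewrite FE fz expr1n mul1r; lra.
Qed.

(* Kallin's lemma for two sets that [psi] maps into the closed half-plane
   [Re <= 0] and into a sector of [Re > 0]. *)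
Lemma kallin_half_plane (Ea Eb : set 'cV[R[i]]_n) psi r (ka kb C : R) :
    0 <= r -> Ea 0 -> Eb 0 -> 0 < ka -> 0 < kb -> 0 <= C ->
    (forall z, Ea z -> Re (poly_val psi z) <= 0 /\
       ka * euclidean_norm z ^+ 2 <= normc (poly_val psi z)) ->
    (forall z, Eb z -> kb * euclidean_norm z ^+ 2 <= normc (poly_val psi z) /\
       normc (poly_val psi z) <= C * Re (poly_val psi z)) ->
    polynomially_convex (Ea `&` closed_euclidean_ball 0 r) ->
    polynomially_convex (Eb `&` closed_euclidean_ball 0 r) ->
  polynomially_convex ((Ea `|` Eb) `&` closed_euclidean_ball 0 r).
Proof.
move=> r0 Ea0 Eb0 ka0 kb0 C0 Ha Hb; rewrite closed_ball0E => ca cb.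
set S := [set _ | _] in ca cb *; set K := _ `&` S.
have KS : K `<=` S by move=> z [].
have S0 : S 0 by rewrite /S /= euclidean_norm0.
apply/seteqP; split; last by apply: subset_poly_hull; exists r.
move=> z Kz; apply: contrapT => nKz.
have na : ~ poly_hull (Ea `&` S) z by rewrite ca => -[? ?]; apply: nKz; split=> //; left.
have nb : ~ poly_hull (Eb `&` S) z by rewrite cb => -[? ?]; apply: nKz; split=> //; right.
have [M M0 HM] := poly_val_bounded psi r0.
have [B HB] := sector_step M C0.
have Ka : Ea `&` S `<=` K by move=> w [Ew Sw]; split=> //; left.
have Kb : Eb `&` S `<=` K by move=> w [Ew Sw]; split=> //; right.
have inb w : K w -> ~ (Ea `&` S) w -> Eb w by move=> [[Ew|//] Sw] [].
have ina w : K w -> ~ (Eb `&` S) w -> Ea w by move=> [[//|Ew] Sw] [].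
have [e1 e10 He1] := peak_bound B r0 KS Ka (conj Ea0 S0) Kz na kb0
  (fun w Kw nw => proj1 (Hb w (inb w Kw nw))).
have [e2 e20 He2] := peak_bound B r0 KS Kb (conj Eb0 S0) Kz nb ka0
  (fun w Kw nw => proj2 (Ha w (ina w Kw nw))).
pose e := Num.min e1 e2; have e0 : 0 < e by rewrite lt_min e10.
have ee1 : e <= e1 by rewrite ge_min lexx.
have ee2 : e <= e2 by rewrite ge_min lexx orbT.
have [p Hp] := HB e e0.
have Kor w : K w -> Re (poly_val psi w) <= 0 \/
    normc (poly_val psi w) <= C * Re (poly_val psi w).
  by move=> [[/Ha[]|/Hb[]] *]; [left|right].
have bnd w : K w -> normc p.[poly_val psi w] <= B /\ normc (1 - p.[poly_val psi w]) <= B.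
  by move=> Kw; have [/(_ (Kor w Kw))] := Hp _ (HM w (KS w Kw)).
have p1E v : (1 - p).[v] = 1 - p.[v] by rewrite hornerD hornerN -polyC1 hornerC.
have h1 : normc (1 - p).[poly_val psi z] < 2^-1.
  apply: He1 => w Kw; rewrite p1E; first exact: (bnd w Kw).2.
  move=> nw ew; have [_ _ H] := Hp _ (HM w (KS w Kw)).
  apply: (le_trans _ ee1); apply: H (le_trans ee1 ew).
  exact: (Hb w (inb w Kw nw)).2.
have h2 : normc p.[poly_val psi z] < 2^-1.
  apply: He2 => w Kw; first exact: (bnd w Kw).1.
  move=> nw ew; have [_ H _] := Hp _ (HM w (KS w Kw)).
  apply: (le_trans _ ee2); apply: H (le_trans ee2 ew).
  exact: (Ha w (ina w Kw nw)).1.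
(* At psi(z) both p and 1 - p have modulus below 1/2, yet they add up to 1. *)
have := le_normcD (1 - p).[poly_val psi z] p.[poly_val psi z].
by rewrite p1E subrK normc1 -p1E; lra.
Qed.

End Kallin.

(** * Totally real planes and quadratic forms *)

Section TotallyReal.
Context {R : realType} {n : nat}.
Implicit Types (z w : 'cV[R[i]]_n) (r : R).

Definition linear_poly (c : 'I_n -> R[i]) : {mpoly R[i][n]} := \sum_(i < n) c i *: 'X_i.

Lemma poly_val_linear c z : poly_val (linear_poly c) z = \sum_(i < n) c i * z i ord0.
Proof.
rewrite /poly_val /linear_poly raddf_sum; apply: eq_bigr => i _ /=.
by rewrite mevalZ mevalXU.
Qed.

Lemma normc_sum (F : 'I_n -> R[i]) : normc (\sum_(i < n) F i) <= \sum_(i < n) normc (F i).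
Proof.
elim/big_rec2: _ => [|i y x _ H]; first by rewrite normc0.
by apply: le_trans (le_normcD _ _) _; rewrite lerD2l.
Qed.

(** A point z outside the ball is separated by the linear form with coefficients conj(z_i): its
    value at z is |z|^2, and on K its modulus is at most (|z|^2 + r^2) / 2. *)
Lemma poly_hull_ball (K : set 'cV[R[i]]_n) r : 0 <= r -> K 0 ->
  K `<=` [set z | euclidean_norm z <= r] -> poly_hull K `<=` [set z | euclidean_norm z <= r].
Proof.
move=> r0 K0 Kr z Kz /=; rewrite leNgt; apply/negP => rz.
pose f := linear_poly (fun i => conjc (z i ord0)).
have fz : poly_val f z = (euclidean_norm z ^+ 2)%:C.
  rewrite poly_val_linear euclidean_norm_sqr rmorph_sum; apply: eq_bigr => i _ /=.
  rewrite normc_sqr; case: (z i ord0) => x y.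
  by apply/eqP; rewrite eq_complex /=; apply/andP; split; apply/eqP; ring.
have fK w : K w -> normc (poly_val f w) <= (euclidean_norm z ^+ 2 + r ^+ 2) / 2.
  move=> /Kr wr; rewrite poly_val_linear; apply: le_trans (normc_sum _) _.
  apply: le_trans (_ : (euclidean_norm z ^+ 2 + euclidean_norm w ^+ 2) / 2 <= _).
    rewrite !euclidean_norm_sqr -big_split /= mulr_suml; apply: ler_sum => i _.
    rewrite normcM.
    have -> : normc (conjc (z i ord0)) = normc (z i ord0).
      by case: (z i ord0) => x y /=; rewrite sqrrN.
    have := sqr_ge0 (normc (z i ord0) - normc (w i ord0)).
    by rewrite sqrrB mulr2n; lra.
  have : euclidean_norm w ^+ 2 <= r ^+ 2.
    by rewrite lerXn2r ?nnegrE ?euclidean_norm_ge0.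
  by lra.
have := poly_hull_le K0 Kz fK; rewrite fz normc_real ger0_norm ?sqr_ge0 //.
have : r ^+ 2 < euclidean_norm z ^+ 2 by rewrite ltrXn2r ?nnegrE ?euclidean_norm_ge0.
by lra.
Qed.

(* A coordinate of [M^-1 z] that is not real, say [u + iv], is separated from
   the real coordinates of the points of K by [D - (X - u)^2], D large. *)
Lemma totally_real_ball_convex (M : 'M[R[i]]_n) r : M \in unitmx -> 0 <= r ->
  polynomially_convex (range (fun x : 'cV[R]_n => M *m complexify x)
                         `&` closed_euclidean_ball 0 r).
Proof.
move=> Mu r0; rewrite closed_ball0E; set K := _ `&` _.
have Kr : K `<=` [set z | euclidean_norm z <= r] by move=> z [].
have K0 : K 0.
  split; last by rewrite /= euclidean_norm0.
  by exists 0 => //; rewrite /complexify map_mx0 mulmx0.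
apply/seteqP; split; last by apply: subset_poly_hull; exists r.
move=> z Kz; split; last exact: poly_hull_ball r0 K0 Kr _ Kz.
pose zeta := invmx M *m z.
suff Im0 i : Im (zeta i ord0) = 0.
  exists (\col_i Re (zeta i ord0)) => //.
  rewrite -[RHS](mulKVmx Mu) -/zeta; congr (_ *m _).
  apply/matrixP => i j; rewrite (ord1 j).
  transitivity (Re (zeta i ord0))%:C; first by rewrite !mxE.
  by apply/eqP; rewrite eq_complex /= eqxx Im0 eqxx.
pose L := linear_poly (fun j => invmx M i j).
have LE w : poly_val L w = (invmx M *m w) i ord0 by rewrite poly_val_linear mxE.
have [c c0 Hc] := poly_val_bounded L r0.
have Lreal w : K w -> Im (poly_val L w) = 0.
  by move=> [[x _ <-] _]; rewrite LE mulKmx // mxE.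
(* As |L| <= c on K, (L - u)^2 lies between 0 and D there, so the test polynomial is at most D; at z
   it equals D + v^2. *)
pose u := Re (zeta i ord0); pose D := (c + `|u|) ^+ 2.
have D0 : 0 <= D by rewrite sqr_ge0.
pose f := mpoly_comp ((D%:C)%:P - ('X - (u%:C)%:P) ^+ 2) L.
have fE w : poly_val f w = D%:C - (poly_val L w - u%:C) ^+ 2.
  by rewrite poly_val_comp hornerD hornerN horner_exp hornerXsubC hornerC.
have fK w : K w -> normc (poly_val f w) <= D.
  move=> Kw; rewrite fE; have := Lreal w Kw; have := Hc w (Kr w Kw).
  have := Re_le_normc (poly_val L w); have := geN_normc_Re (poly_val L w).
  case: (poly_val L w) => s t; set N := normc _ => Ns sN Nc.
  move=> t0; have {t0}-> : t = 0 := t0; rewrite /= in Ns sN.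
  have -> : D%:C - ((s +i* 0) - u%:C) ^+ 2 = (D - (s - u) ^+ 2)%:C.
    by apply/eqP; rewrite eq_complex /=; apply/andP; split; apply/eqP; ring.
  rewrite normc_real ler_norml.
  have : (s - u) ^+ 2 <= D.
    rewrite /D -(real_normK (num_real (s - u))) lerXn2r ?nnegrE ?addr_ge0 //.
    apply: le_trans (ler_normB _ _) _; rewrite lerD2r ler_norml; apply/andP; split; lra.
  by have := sqr_ge0 (s - u) => *; apply/andP; split; lra.
have H := poly_hull_le K0 Kz fK; rewrite fE LE -/zeta in H.
move: H; have : zeta i ord0 = u +i* Im (zeta i ord0).
  by rewrite /u; case: (zeta i ord0).
move: (Im (zeta i ord0)) => v ->.
have -> : D%:C - ((u +i* v) - u%:C) ^+ 2 = (D + v ^+ 2)%:C.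
  by apply/eqP; rewrite eq_complex /=; apply/andP; split; apply/eqP; ring.
rewrite normc_real ger0_norm ?addr_ge0 ?sqr_ge0 // => H.
apply/eqP; rewrite -sqrf_eq0 eq_le sqr_ge0 andbT; lra.
Qed.

End TotallyReal.

Section BinaryForms.
Context {R : realType}.
Implicit Types (p q r x y u v : R).

(** The symmetric bilinear form of the matrix [[p, q], [q, r]] at (u, v) and (x, y). *)
Definition bform p q r u v x y := p * (u * x) + q * (u * y + v * x) + r * (v * y).

(** Cayley-Hamilton for a symmetric matrix F, (tr F) F = F^2 + (det F) I. It provides the lower
    bound det F / tr F for the form without eigenvalues. *)
Lemma bform_trace_mul p q r x y :
  (p + r) * bform p q r x y x y =
  (p * x + q * y) ^+ 2 + (q * x + r * y) ^+ 2 + (p * r - q ^+ 2) * (x ^+ 2 + y ^+ 2).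
Proof. by rewrite /bform; ring. Qed.

Lemma bform_ge p q r : 0 <= p -> 0 <= r -> q ^+ 2 < p * r ->
  exists2 k : R, 0 < k & forall x y, k * (x ^+ 2 + y ^+ 2) <= bform p q r x y x y.
Proof.
move=> p0 r0 d; have t0 : 0 < p + r by have := sqr_ge0 q; nra.
exists ((p * r - q ^+ 2) / (p + r)); first by rewrite divr_gt0 // subr_gt0.
move=> x y; rewrite mulrAC ler_pdivrMr // [leRHS]mulrC bform_trace_mul.
by rewrite lerDr addr_ge0 ?sqr_ge0.
Qed.

Lemma bform_ge0 p q r x y : 0 <= p -> 0 <= r -> q ^+ 2 <= p * r ->
  0 <= bform p q r x y x y.
Proof.
move=> p0 r0 d; have [t0|t0] := ltP 0 (p + r).
  rewrite -(pmulr_rge0 _ t0) bform_trace_mul.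
  by rewrite !addr_ge0 ?sqr_ge0 // mulr_ge0 ?subr_ge0 ?addr_ge0 ?sqr_ge0.
have pe : p = 0 by lra.
have re : r = 0 by lra.
have /eqP : q ^+ 2 = 0 by apply/eqP; rewrite eq_le sqr_ge0 andbT; rewrite pe mul0r in d.
by rewrite sqrf_eq0 => /eqP qe; rewrite /bform pe re qe !mul0r !addr0.
Qed.

Lemma bform_le p q r : exists2 C : R, 0 <= C &
  forall x y, bform p q r x y x y <= C * (x ^+ 2 + y ^+ 2).
Proof.
exists (`|p| + `|q| + `|r|); first by rewrite !addr_ge0.
move=> x y; have := ler_norm p; have := ler_norm q; have := ler_norm r.
have := ler_norm (- q); rewrite normrN.
have := sqr_ge0 (x - y); have := sqr_ge0 (x + y); have := sqr_ge0 x; have := sqr_ge0 y.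
have := normr_ge0 p; have := normr_ge0 q; have := normr_ge0 r; rewrite /bform.
move: `|p| `|q| `|r| => P Q S *.
have : p * x ^+ 2 <= P * x ^+ 2 by rewrite ler_wpM2r.
have : r * y ^+ 2 <= S * y ^+ 2 by rewrite ler_wpM2r.
have : P * y ^+ 2 >= 0 by rewrite mulr_ge0.
have : S * x ^+ 2 >= 0 by rewrite mulr_ge0.
have : (Q - q) * (x + y) ^+ 2 >= 0 by rewrite mulr_ge0 // subr_ge0.
have : (Q + q) * (x - y) ^+ 2 >= 0 by rewrite mulr_ge0 //; lra.
lra.
Qed.

Definition quad_mpoly (a b c : R[i]) : {mpoly R[i][2]} :=
  a *: ('X_0 ^+ 2) + (2 * b) *: ('X_0 * 'X_1) + c *: ('X_1 ^+ 2).

Lemma poly_val_quad_mpoly (a1 b1 a2 b2 a3 b3 u x v y : R) (z : 'cV[R[i]]_2) :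
    z 0 ord0 = u +i* x -> z 1 ord0 = v +i* y ->
  poly_val (quad_mpoly (a1 +i* b1) (a2 +i* b2) (a3 +i* b3)) z =
  (bform a1 a2 a3 u v u v - bform a1 a2 a3 x y x y - 2 * bform b1 b2 b3 u v x y) +i*
  (bform b1 b2 b3 u v u v - bform b1 b2 b3 x y x y + 2 * bform a1 a2 a3 u v x y).
Proof.
move=> z0 z1; rewrite /poly_val /quad_mpoly !mevalD !mevalZ !mevalM !mevalXU.
rewrite z0 z1 /bform.
have -> : (2 : R[i]) = 2 +i* 0 by rewrite -[RHS]/(2%:C) rmorph_nat.
by apply/eqP; rewrite eq_complex /=; apply/andP; split; apply/eqP; ring.
Qed.

Lemma euclidean_norm2_sqr (u x v y : R) (z : 'cV[R[i]]_2) :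
    z 0 ord0 = u +i* x -> z 1 ord0 = v +i* y ->
  euclidean_norm z ^+ 2 = u ^+ 2 + x ^+ 2 + (v ^+ 2 + y ^+ 2).
Proof.
move=> z0 z1; rewrite euclidean_norm_sqr big_ord_recl big_ord1.
have -> : lift ord0 ord0 = 1 :> 'I_2 by apply/val_inj.
by rewrite z0 z1 !normc_sqr.
Qed.

End BinaryForms.

(** * Matrices self-adjoint for a positive definite form; the case of equal signs *)

Section SelfAdjoint.
Context {R : realType}.
Variables (p q r : R).
Hypotheses (p_ge0 : 0 <= p) (r_ge0 : 0 <= r) (pqr : q ^+ 2 < p * r).
Implicit Types (a b c d e h x y : R) (z : 'cV[R[i]]_2).

Local Notation Q x y := (bform p q r x y x y).

(** Symmetry of the product of Q = [[p, q], [q, r]] with A = [[a, b], [c, d]]. *)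
Definition selfadjoint a b c d := p * b + q * d - (q * a + r * c) = 0.

(** z is the image of the real vector (x, y) under A + iI. *)
Definition in_plane a b c d x y z :=
  z 0 ord0 = (a * x + b * y) +i* x /\ z 1 ord0 = (c * x + d * y) +i* y.

(** In this and the next identities the two sides differ by a multiple of the expression that
    [selfadjoint] equates to 0. *)
Lemma bform_adj a b c d x y : selfadjoint a b c d ->
  bform p q r (a * x + b * y) (c * x + d * y) x y =
  bform (p * a + q * c) (q * a + r * c) (q * b + r * d) x y x y.
Proof.
move=> H; apply/eqP; rewrite -subr_eq0; apply/eqP.
transitivity ((p * b + q * d - (q * a + r * c)) * (x * y)); first by rewrite /bform; ring.
by rewrite H mul0r.
Qed.

Lemma det_adj a b c d : selfadjoint a b c d ->
  (p * a + q * c) * (q * b + r * d) - (q * a + r * c) ^+ 2 =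
  (p * r - q ^+ 2) * (a * d - b * c).
Proof.
move=> H; apply/eqP; rewrite -subr_eq0; apply/eqP.
transitivity ((p * b + q * d - (q * a + r * c)) * (q * a + r * c)); first by ring.
by rewrite H mul0r.
Qed.

(** By self-adjointness the left side is Q(A^2 v, v), and A^2 = (tr A) A - (det A) I. *)
Lemma selfadjoint_cayley a b c d x y : selfadjoint a b c d ->
  Q (a * x + b * y) (c * x + d * y) =
  (a + d) * bform p q r (a * x + b * y) (c * x + d * y) x y - (a * d - b * c) * Q x y.
Proof.
move=> H; apply/eqP; rewrite -subr_eq0; apply/eqP.
transitivity ((p * b + q * d - (q * a + r * c)) *
    ((a * x + b * y) * y - (c * x + d * y) * x)); first by rewrite /bform; ring.
by rewrite H mul0r.
Qed.

Lemma bform_adj_square a b c d x y : selfadjoint a b c d ->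
  bform (p * a + q * c) (q * a + r * c) (q * b + r * d) (a * x + b * y) (c * x + d * y) x y =
  Q (a * x + b * y) (c * x + d * y).
Proof.
move=> H; apply/eqP; rewrite -subr_eq0; apply/eqP.
transitivity (- (p * b + q * d - (q * a + r * c)) * (y * (a * x + b * y))).
  by rewrite /bform; ring.
by rewrite H oppr0 mul0r.
Qed.

(** The eigenvalues would be i and -i, but those of a self-adjoint matrix are real. Concretely,
    [selfadjoint_cayley] at the second basis vector would read Q(A e2, A e2) = -r < 0. *)
Lemma selfadjoint_no_eigen_i a b c d : selfadjoint a b c d ->
  a + d = 0 -> a * d - b * c = 1 -> False.
Proof.
move=> H t0 D1; have dE : d = - a by rewrite -[d](addKr a) t0 addr0.
have bc : b * c = - 1 - a ^+ 2 by rewrite -D1 dE; ring.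
have : Q b (- a) + r = 0.
  transitivity (b * (p * b + q * d - (q * a + r * c)) + r * (b * c + a ^+ 2 + 1)).
    by rewrite dE /bform; ring.
  by rewrite H bc; ring.
have := bform_ge0 b (- a) p_ge0 r_ge0 (ltW pqr).
have r0 : 0 < r.
  rewrite lt_def r_ge0 andbT; apply: contraTneq pqr => ->.
  by rewrite mulr0 -leNgt sqr_ge0.
lra.
Qed.

(** As det (QA) = det Q det A >= 0, the diagonal entries of the symmetric matrix QA have a
    nonnegative product, hence a common sign e. *)
Lemma selfadjoint_semidefinite a b c d : selfadjoint a b c d -> 0 <= a * d - b * c ->
  exists2 e, e = 1 \/ e = -1 & 0 <= e * (p * a + q * c) /\ 0 <= e * (q * b + r * d).
Proof.
move=> H D; have := det_adj H.
have : 0 <= (p * r - q ^+ 2) * (a * d - b * c) by rewrite mulr_ge0 // subr_ge0 ltW.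
have := sqr_ge0 (q * a + r * c); move: (_ ^+ 2) (p * a + q * c) (q * b + r * d) (_ * (a * d - _)).
move=> m s t g m0 g0 E; have st : 0 <= s * t by lra.
have [s0|s0] := leP 0 s; have [t0|t0] := leP 0 t.
- by exists 1; [left | lra].
- by exists (-1); [right | split; [nra | lra]].
- by exists (-1); [right | split; [lra | nra]].
- by exists (-1); [right | split; lra].
Qed.

Lemma sign_bform_ge0 a b c d e x y : selfadjoint a b c d -> 0 <= a * d - b * c ->
    e = 1 \/ e = -1 -> 0 <= e * (p * a + q * c) -> 0 <= e * (q * b + r * d) ->
  0 <= e * bform p q r (a * x + b * y) (c * x + d * y) x y.
Proof.
move=> H D e1 es et; rewrite bform_adj //.
have -> : e * bform (p * a + q * c) (q * a + r * c) (q * b + r * d) x y x y =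
  bform (e * (p * a + q * c)) (e * (q * a + r * c)) (e * (q * b + r * d)) x y x y.
  by rewrite /bform; ring.
have ee : e ^+ 2 = 1 by case: e1 => ->; rewrite ?sqrrN expr1n.
apply: bform_ge0 => //; rewrite mulrACA -expr2 exprMn ee !mul1r -subr_ge0 det_adj //.
by rewrite mulr_ge0 // subr_ge0 ltW.
Qed.

Lemma in_plane_norm_le a b c d : exists2 N : R, 0 < N & forall x y z,
  in_plane a b c d x y z -> euclidean_norm z ^+ 2 <= N * (x ^+ 2 + y ^+ 2).
Proof.
exists (1 + (a ^+ 2 + b ^+ 2 + (c ^+ 2 + d ^+ 2))).
  by rewrite ltr_pwDl // !addr_ge0 ?sqr_ge0.
move=> x y z [z0 z1]; rewrite (euclidean_norm2_sqr z0 z1).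
have := sqr_ge0 (a * y - b * x); have := sqr_ge0 (c * y - d * x).
nra.
Qed.

Lemma form_dominates a b c d (f1 f2 f3 : R) : 0 <= f1 -> 0 <= f3 -> f2 ^+ 2 < f1 * f3 ->
  exists2 k : R, 0 < k & forall x y z, in_plane a b c d x y z ->
    k * euclidean_norm z ^+ 2 <= bform f1 f2 f3 x y x y.
Proof.
move=> f10 f30 f; have [k k0 Hk] := bform_ge f10 f30 f.
have [N N0 HN] := in_plane_norm_le a b c d.
exists (k / N); first by rewrite divr_gt0.
move=> x y z /HN zN; apply: le_trans (Hk x y).
by rewrite -mulrA ler_pM2l // ler_pdivrMl.
Qed.

Lemma normc_quad_mpoly_le (A B C : R[i]) : exists2 N : R, 0 <= N & forall z : 'cV[R[i]]_2,
  normc (poly_val (quad_mpoly A B C) z) <= N * euclidean_norm z ^+ 2.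
Proof.
exists (normc A + normc (2 * B) + normc C); first by rewrite !addr_ge0 ?normc_ge0.
move=> z; rewrite /poly_val /quad_mpoly !mevalD !mevalZ !mevalM !mevalXU.
have z0 := normc_coord_le z 0; have z1 := normc_coord_le z 1.
apply: le_trans (le_normcD _ _) _.
apply: le_trans (lerD (le_normcD _ _) (lexx _)) _.
rewrite !normcM !mulrDl; move: (euclidean_norm z) z0 z1 => n z0 z1.
rewrite expr2; have m i j : normc (z i ord0) <= n -> normc (z j ord0) <= n ->
    normc (z i ord0) * normc (z j ord0) <= n * n by move=> *; rewrite ler_pM ?normc_ge0.
by rewrite !lerD // ler_wpM2l ?mulr_ge0 ?normc_ge0 // m.
Qed.

Definition tilt e h : {mpoly R[i][2]} :=
  quad_mpoly ((h * p) +i* (e * p)) ((h * q) +i* (e * q)) ((h * r) +i* (e * r)).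

(** On the plane, Re psi = h (Q(Av, Av) - Q(v, v)) - 2 e Q(Av, v), where e Q(Av, v) >= 0. By
    [selfadjoint_cayley] and h |tr A| <= 1, the term h Q(Av, Av) is at most e Q(Av, v), so Re psi <=
    - h Q(v, v). *)
Lemma tilt_plane a b c d e h : selfadjoint a b c d -> 0 <= a * d - b * c ->
    e = 1 \/ e = -1 -> 0 <= e * (p * a + q * c) -> 0 <= e * (q * b + r * d) ->
    0 < h -> h * `|a + d| <= 1 ->
  exists2 k : R, 0 < k & forall x y z, in_plane a b c d x y z ->
    Re (poly_val (tilt e h) z) <= 0 /\
    k * euclidean_norm z ^+ 2 <= normc (poly_val (tilt e h) z).
Proof.
move=> H D e1 es et h0 ht.
have [k k0 Hk] := @form_dominates a b c d p q r p_ge0 r_ge0 pqr.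
exists (h * k) => [|x y z zP]; first by rewrite mulr_gt0.
have S0 := sign_bform_ge0 x y H D e1 es et; have C := selfadjoint_cayley x y H.
have Qx := bform_ge0 x y p_ge0 r_ge0 (ltW pqr); have kz := Hk x y z zP.
have [z0 z1] := zP; have E := poly_val_quad_mpoly (h * p) (e * p) (h * q) (e * q) (h * r) (e * r) z0 z1.
have RE : Re (poly_val (tilt e h) z) = h * Q (a * x + b * y) (c * x + d * y) - h * Q x y
    - 2 * (e * bform p q r (a * x + b * y) (c * x + d * y) x y).
  by rewrite E /= /bform; ring.
have tB : (a + d) * bform p q r (a * x + b * y) (c * x + d * y) x y <=
    `|a + d| * (e * bform p q r (a * x + b * y) (c * x + d * y) x y).
  apply: le_trans (ler_norm _) _; rewrite normrM.
  rewrite -(ger0_norm S0) normrM; have -> : `|e| = 1 by case: e1 => ->; rewrite ?normrN normr1.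
  by rewrite mul1r.
have up : Re (poly_val (tilt e h) z) <= - (h * Q x y).
  rewrite RE C; move: S0 tB Qx ht; move: (bform _ _ _ x y x y) (a * d - b * c) D => X dt dt0.
  move: (bform _ _ _ _ _ x y) (`|a + d|) => B t S0 tB X0 ht.
  have : h * ((a + d) * B) <= h * (t * (e * B)) by rewrite ler_pM2l.
  have : h * t * (e * B) <= e * B by rewrite ler_piMl.
  have : 0 <= h * (dt * X) by rewrite mulr_ge0 ?mulr_ge0 // ltW.
  lra.
have hQ : 0 <= h * Q x y by rewrite mulr_ge0 // ltW.
split; first by lra.
have : h * k * euclidean_norm z ^+ 2 <= h * Q x y by rewrite -mulrA ler_pM2l.
by have := geN_normc_Re (poly_val (tilt e h) z); lra.
Qed.

(** On the real plane psi = (h + e i) Q(v, v), so |psi| <= (h + 1) Q(v, v) and C = (h + 1) / h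
    serves. *)
Lemma tilt_real e h : e = 1 \/ e = -1 -> 0 < h ->
  exists k C : R, [/\ 0 < k, 0 <= C & forall x y z, z 0 ord0 = x%:C -> z 1 ord0 = y%:C ->
    k * euclidean_norm z ^+ 2 <= normc (poly_val (tilt e h) z) /\
    normc (poly_val (tilt e h) z) <= C * Re (poly_val (tilt e h) z)].
Proof.
move=> e1 h0; have [k k0 Hk] := bform_ge p_ge0 r_ge0 pqr.
exists (h * k), ((h + 1) / h); split; [by rewrite mulr_gt0|by rewrite divr_ge0 //; lra|].
move=> x y z z0 z1; rewrite (euclidean_norm2_sqr z0 z1) expr0n !addr0.
have E := poly_val_quad_mpoly (h * p) (e * p) (h * q) (e * q) (h * r) (e * r) z0 z1.
have RE : Re (poly_val (tilt e h) z) = h * Q x y by rewrite E /= /bform; ring.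
have IE : Im (poly_val (tilt e h) z) = e * Q x y by rewrite E /= /bform; ring.
have Q0 := bform_ge0 x y p_ge0 r_ge0 (ltW pqr).
split.
  by apply: le_trans (Re_le_normc _); rewrite RE -mulrA ler_pM2l.
apply: le_trans (normc_le_ReIm _) _; rewrite RE IE !normrM (gtr0_norm h0) (ger0_norm Q0).
have -> : `|e| = 1 by case: e1 => ->; rewrite ?normrN normr1.
by rewrite mulrA divfK ?gt_eqF // mulrDl.
Qed.

End SelfAdjoint.

(** * The case of opposite signs *)

Section OppositeSigns.
Context {R : realType}.
Variables (p q r : R).
Hypotheses (p_ge0 : 0 <= p) (r_ge0 : 0 <= r) (pqr : q ^+ 2 < p * r).
Implicit Types (h x y : R) (z : 'cV[R[i]]_2).
Variables (a b c d a' b' c' d' e : R).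
Hypotheses (sa1 : selfadjoint p q r a b c d) (sa2 : selfadjoint p q r a' b' c' d').
Hypotheses (det1 : a * d - b * c = 0) (det2 : 0 <= a' * d' - b' * c').
Hypothesis (e1 : e = 1 \/ e = -1).
Hypotheses (es : 0 <= e * (p * a + q * c)) (et : 0 <= e * (q * b + r * d)).
Hypotheses (es' : 0 <= - e * (p * a' + q * c')) (et' : 0 <= - e * (q * b' + r * d')).

Local Notation Q x y := (bform p q r x y x y).
Local Notation s1 := (e * (p * a + q * c)).
Local Notation s2 := (e * (q * a + r * c)).
Local Notation s3 := (e * (q * b + r * d)).
Local Notation t1 := (- e * (p * a' + q * c')).
Local Notation t2 := (- e * (q * a' + r * c')).
Local Notation t3 := (- e * (q * b' + r * d')).

(** For h = 0 the real part on P_2 is 2 T with T = - e Q(A_2 v, v) >= 0, which may degenerate. The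
    term in h adds h S(v), and for m < 0 the form T + h S is positive definite. *)
Definition tilt_kernel h : {mpoly R[i][2]} :=
  quad_mpoly ((- h * s1) +i* (e * p)) ((- h * s2) +i* (e * q)) ((- h * s3) +i* (e * r)).

Let ee : e ^+ 2 = 1.
Proof. by case: e1 => ->; rewrite ?sqrrN expr1n. Qed.

Let e1' : - e = 1 \/ - e = -1.
Proof. by case: e1 => ->; rewrite ?opprK; [right|left]. Qed.

Let norm_e : `|e| = 1.
Proof. by case: e1 => ->; rewrite ?normrN normr1. Qed.

Let s_det : s2 ^+ 2 = s1 * s3.
Proof.
apply/esym/eqP; rewrite mulrACA -expr2 exprMn ee !mul1r -subr_eq0 det_adj //.
by rewrite det1 mulr0.
Qed.

Let t_det : t2 ^+ 2 <= t1 * t3.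
Proof.
rewrite mulrACA -expr2 exprMn sqrrN ee !mul1r -subr_ge0 det_adj //.
by rewrite mulr_ge0 // subr_ge0 ltW.
Qed.

Let S x y := bform s1 s2 s3 x y x y.

Let S_ge0 x y : 0 <= S x y.
Proof. by apply: bform_ge0 => //; rewrite s_det. Qed.

Lemma tilt_kernel_real : exists2 k : R, 0 < k & forall h x y z, 0 <= h ->
  z 0 ord0 = x%:C -> z 1 ord0 = y%:C ->
  Re (poly_val (tilt_kernel h) z) <= 0 /\
  k * euclidean_norm z ^+ 2 <= normc (poly_val (tilt_kernel h) z).
Proof.
have [k k0 Hk] := bform_ge p_ge0 r_ge0 pqr; exists k => // h x y z h0 z0 z1.
rewrite (euclidean_norm2_sqr z0 z1) expr0n !addr0.
have E := poly_val_quad_mpoly (- h * s1) (e * p) (- h * s2) (e * q) (- h * s3) (e * r) z0 z1.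
have RE : Re (poly_val (tilt_kernel h) z) = - (h * S x y) by rewrite E /= /S /bform; ring.
have IE : Im (poly_val (tilt_kernel h) z) = e * Q x y by rewrite E /= /bform; ring.
split; first by rewrite RE oppr_le0 mulr_ge0.
have Q0 := bform_ge0 x y p_ge0 r_ge0 (ltW pqr).
have : `|Im (poly_val (tilt_kernel h) z)| <= normc (poly_val (tilt_kernel h) z).
  rewrite -(@ler_pXn2r _ 2) ?nnegrE ?normc_ge0 // real_normK ?num_real // normc_sqr.
  by rewrite lerDr sqr_ge0.
by rewrite IE normrM norm_e mul1r (ger0_norm Q0); apply: le_trans.
Qed.

(** As det A_1 = 0, Q(A_1 v, A_1 v) and the form of S at (A_1 v, v) are both, up to the sign e,
    multiples of S(v) by the trace. Hence Re psi <= - S(v), and Im psi is - e Q(v, v) up to 3 |tr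
    A_1| S(v): one part bounds S, and then the other bounds Q. *)
Lemma tilt_kernel_plane1 : exists2 k : R, 0 < k & forall h x y z, 0 <= h <= 1 ->
  in_plane a b c d x y z ->
  Re (poly_val (tilt_kernel h) z) <= 0 /\
  k * euclidean_norm z ^+ 2 <= normc (poly_val (tilt_kernel h) z).
Proof.
have [k k0 Hk] := form_dominates a b c d p_ge0 r_ge0 pqr.
have K0 : 0 < 1 + 3 * `|a + d| by have := normr_ge0 (a + d); lra.
exists (k / (1 + 3 * `|a + d|)); first by rewrite divr_gt0.
move=> h x y z /andP[h0 h1] zP; have kz := Hk x y z zP.
have [z0 z1] := zP.
have E := poly_val_quad_mpoly (- h * s1) (e * p) (- h * s2) (e * q) (- h * s3) (e * r) z0 z1.
pose u := a * x + b * y; pose v := c * x + d * y.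
have SB : S x y = e * bform p q r u v x y by rewrite bform_adj // /S /bform; ring.
have QE : Q u v = (a + d) * (e * S x y).
  by rewrite selfadjoint_cayley // det1 mul0r subr0 SB [e * (e * _)]mulrA -expr2 ee mul1r.
have SE : bform s1 s2 s3 u v x y = (a + d) * S x y.
  transitivity (e * Q u v); last by rewrite QE mulrCA [e * (e * _)]mulrA -expr2 ee mul1r.
  by rewrite -(bform_adj_square x y sa1) /bform /u /v; ring.
have RE : Re (poly_val (tilt_kernel h) z) = - (h * S u v) + h * S x y - 2 * S x y.
  by rewrite [X in 2 * X]SB E /= /S /bform /u /v; ring.
have IE : Im (poly_val (tilt_kernel h) z) =
    (a + d) * S x y * (1 - 2 * h) - e * Q x y.
  transitivity (e * Q u v - e * Q x y - 2 * h * bform s1 s2 s3 u v x y).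
    by rewrite E /= /bform /u /v; ring.
  rewrite QE SE; transitivity ((a + d) * S x y * (e ^+ 2 - 2 * h) - e * Q x y); first by ring.
  by rewrite ee.
have S0 := S_ge0 x y; have S1 := S_ge0 u v.
have hS0 : 0 <= h * S u v by rewrite mulr_ge0.
have hS1 : h * S x y <= S x y by rewrite ler_piMl.
split; first by rewrite RE; lra.
rewrite mulrAC ler_pdivrMr //; apply: le_trans kz _.
have Rn := geN_normc_Re (poly_val (tilt_kernel h) z).
have In : `|Im (poly_val (tilt_kernel h) z)| <= normc (poly_val (tilt_kernel h) z).
  rewrite -(@ler_pXn2r _ 2) ?nnegrE ?normc_ge0 // real_normK ?num_real // normc_sqr.
  by rewrite lerDr sqr_ge0.
have SN : S x y <= normc (poly_val (tilt_kernel h) z) by lra.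
have Q0 := bform_ge0 x y p_ge0 r_ge0 (ltW pqr).
have QN : Q x y <= `|Im (poly_val (tilt_kernel h) z)| + 3 * (`|a + d| * S x y).
  have -> : Q x y = `|e * Q x y| by rewrite normrM norm_e mul1r ger0_norm.
  have -> : e * Q x y = (a + d) * S x y * (1 - 2 * h) - Im (poly_val (tilt_kernel h) z).
    by rewrite IE; ring.
  apply: le_trans (ler_normB _ _) _; rewrite addrC lerD2l !normrM (ger0_norm S0).
  rewrite [leRHS]mulrC ler_wpM2l ?mulr_ge0 // ler_norml; apply/andP; split; lra.
have : `|a + d| * S x y <= `|a + d| * normc (poly_val (tilt_kernel h) z).
  by rewrite ler_wpM2l.
lra.
Qed.

(* The coefficient of [h] in the determinant of the sum of [h] times the first
   matrix and the second one. *)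
Let m := a * d' + a' * d - b * c' - b' * c.

(** The strict hypothesis excludes m = 0. Moreover - m det Q is the mixed discriminant of the
    semidefinite matrices e Q A_1 and - e Q A_2, nonnegative because (2 s2 t2)^2 <= 4 s1 s3 t1 t3 <=
    (s1 t3 + s3 t1)^2. *)
Lemma mixed_discriminant_lt0 :
    0 < m * ((a + d) * (a' + d') - m) - (a + d) ^+ 2 * (a' * d' - b' * c') -> m < 0.
Proof.
move=> D; rewrite lt_neqAle; apply/andP; split.
  apply: contraTneq D => ->; rewrite mul0r sub0r oppr_gt0 -leNgt mulr_ge0 ?sqr_ge0 //.
have dQ : 0 < p * r - q ^+ 2 by rewrite subr_gt0.
rewrite -(pmulr_rle0 _ dQ).
have mE : (p * r - q ^+ 2) * m = - (s1 * t3 + s3 * t1 - 2 * (s2 * t2)).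
  transitivity (e ^+ 2 * ((p * r - q ^+ 2) * m)); first by rewrite ee mul1r.
  apply/eqP; rewrite -subr_eq0; apply/eqP.
  transitivity (- e ^+ 2 * ((p * b + q * d - (q * a + r * c)) * (q * a' + r * c') +
     (p * b' + q * d' - (q * a' + r * c')) * (q * a + r * c))); first by rewrite /m; ring.
  by rewrite sa1 sa2 !mul0r addr0 mulr0.
rewrite mE oppr_le0 subr_ge0.
have A0 : 0 <= s1 * t3 + s3 * t1 by apply: addr_ge0; apply: mulr_ge0.
have : (2 * (s2 * t2)) ^+ 2 <= (s1 * t3 + s3 * t1) ^+ 2.
  apply: le_trans (_ : 4 * (s1 * s3 * (t1 * t3)) <= _).
    rewrite exprMn exprMn s_det; have -> : 2 ^+ 2 = 4 :> R by ring.
    by rewrite ler_pM2l // ler_wpM2l ?(mulr_ge0 es et).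
  rewrite -subr_ge0; have -> : (s1 * t3 + s3 * t1) ^+ 2 - 4 * (s1 * s3 * (t1 * t3)) =
    (s1 * t3 - s3 * t1) ^+ 2 by ring.
  exact: sqr_ge0.
move=> H; apply: le_trans (ler_norm _) _.
rewrite -(@ler_pXn2r _ 2) ?nnegrE ?normr_ge0 // real_normK ?num_real //.
Qed.

Lemma tilt_kernel_plane2 : m < 0 -> exists h k C : R,
  [/\ 0 <= h <= 1, 0 < k, 0 <= C & forall x y z, in_plane a' b' c' d' x y z ->
    k * euclidean_norm z ^+ 2 <= normc (poly_val (tilt_kernel h) z) /\
    normc (poly_val (tilt_kernel h) z) <= C * Re (poly_val (tilt_kernel h) z)].
Proof.
move=> m0.
have [C1 C10 HC1] := bform_le s1 s2 s3.
have [k0 k00 Hk0] := bform_ge p_ge0 r_ge0 pqr.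
(* The chain S(A_2 v) <= C1 |A_2 v|^2 <= (C1 / k0) Q(A_2 v, A_2 v) <= K T lets h = 1 / (1 + K) keep
   h S(A_2 v) below T. *)
pose K := C1 / k0 * `|a' + d'|.
have K0 : 0 <= K by rewrite mulr_ge0 // divr_ge0 // ltW.
pose h := (1 + K)^-1.
have h0 : 0 < h by rewrite invr_gt0; lra.
have h1 : h <= 1 by rewrite invf_le1; lra.
have hK : h * K <= 1 by rewrite mulrC ler_pdivrMr; lra.
have f1 : 0 <= t1 + h * s1 by rewrite addr_ge0 // mulr_ge0 // ltW.
have f3 : 0 <= t3 + h * s3 by rewrite addr_ge0 // mulr_ge0 // ltW.
have f2 : (t2 + h * s2) ^+ 2 < (t1 + h * s1) * (t3 + h * s3).
  rewrite -subr_gt0.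
  (* The matrix of T + h S is e Q (h A_1 - A_2), with determinant det Q (- h m + det A_2) > 0 since
     det A_1 = 0. *)
  have sa3 : selfadjoint p q r (h * a - a') (h * b - b') (h * c - c') (h * d - d').
    transitivity (h * (p * b + q * d - (q * a + r * c)) -
      (p * b' + q * d' - (q * a' + r * c'))); first by rewrite /selfadjoint; ring.
    by rewrite sa1 sa2 mulr0 subr0.
  have -> : (t1 + h * s1) * (t3 + h * s3) - (t2 + h * s2) ^+ 2 = e ^+ 2 *
     ((p * (h * a - a') + q * (h * c - c')) * (q * (h * b - b') + r * (h * d - d')) -
      (q * (h * a - a') + r * (h * c - c')) ^+ 2) by ring.
  rewrite ee mul1r det_adj //; apply: mulr_gt0; first by rewrite subr_gt0.
  have -> : (h * a - a') * (h * d - d') - (h * b - b') * (h * c - c') =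
    h ^+ 2 * (a * d - b * c) + h * (- m) + (a' * d' - b' * c') by rewrite /m; ring.
  by rewrite det1 mulr0 add0r ltr_pwDl // mulr_gt0 // oppr_gt0.
have [k kk0 Hk] := form_dominates a' b' c' d' f1 f3 f2.
have [N N0 HN] := normc_quad_mpoly_le ((- h * s1) +i* (e * p)) ((- h * s2) +i* (e * q)) ((- h * s3) +i* (e * r)).
exists h, k, (N / k); split=> //; first by rewrite ltW.
  by rewrite divr_ge0 // ltW.
move=> x y z zP; have kz := Hk x y z zP; have [z0 z1] := zP.
have E := poly_val_quad_mpoly (- h * s1) (e * p) (- h * s2) (e * q) (- h * s3) (e * r) z0 z1.
pose u := a' * x + b' * y; pose v := c' * x + d' * y.
pose T := - e * bform p q r u v x y.
have T0 : 0 <= T by apply: sign_bform_ge0.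
have TE : T = bform t1 t2 t3 x y x y by rewrite /T bform_adj // /bform; ring.
have RE : Re (poly_val (tilt_kernel h) z) = 2 * T + h * S x y - h * S u v.
  by rewrite E /= /S /T /bform /u /v; ring.
have Quv : Q u v <= `|a' + d'| * T.
  rewrite selfadjoint_cayley // -/u -/v.
  have : 0 <= (a' * d' - b' * c') * Q x y.
    by rewrite mulr_ge0 //; apply: bform_ge0 => //; apply: ltW.
  have : (a' + d') * bform p q r u v x y <= `|a' + d'| * T.
    apply: le_trans (ler_norm _) _; rewrite normrM -(ger0_norm T0) /T normrM normrN norm_e.
    by rewrite mul1r.
  lra.
have Suv : S u v <= K * T.
  apply: le_trans (HC1 u v) _.
  have uv : u ^+ 2 + v ^+ 2 <= k0^-1 * (`|a' + d'| * T).
    by rewrite ler_pdivlMl //; apply: le_trans (Hk0 u v) Quv.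
  by have := ler_wpM2l C10 uv; rewrite /K !mulrA.
have hS : h * S u v <= T.
  apply: le_trans (_ : h * (K * T) <= _); first by rewrite ler_pM2l.
  by rewrite mulrA ler_piMl.
have FE : bform (t1 + h * s1) (t2 + h * s2) (t3 + h * s3) x y x y = T + h * S x y.
  by rewrite TE /S /bform; ring.
have kR : k * euclidean_norm z ^+ 2 <= Re (poly_val (tilt_kernel h) z).
  by rewrite RE; rewrite FE in kz; lra.
split; first exact: le_trans kR (Re_le_normc _).
apply: le_trans (HN z) _; rewrite -mulrA ler_wpM2l //.
by rewrite ler_pdivlMl.
Qed.

End OppositeSigns.

(** * From the matrices to the quadratic forms, and the conclusion *)

Section Matrices.
Context {R : realType}.
Implicit Types (A B : 'M[R]_2) (z : 'cV[R[i]]_2) (x y r : R).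

Lemma mulmx2E {S : pzSemiRingType} {k} (A : 'M[S]_2) (B : 'M[S]_(2, k)) i j :
  (A *m B) i j = A i 0 * B 0 j + A i 1 * B 1 j.
Proof.
rewrite mxE big_ord_recl big_ord1.
by have -> : lift ord0 ord0 = 1 :> 'I_2 by apply/val_inj.
Qed.

Lemma image_of_R2_coords A z : image_of_R2 (complexify A + ('i%C)%:M) z ->
  exists x y, in_plane (A 0 0) (A 0 1) (A 1 0) (A 1 1) x y z.
Proof.
move=> [v _ <-]; exists (v 0 ord0), (v 1 ord0).
by split; rewrite mulmx2E !mxE /=; apply/eqP; rewrite eq_complex /=;
  apply/andP; split; apply/eqP; ring.
Qed.

Lemma R2_coords z : range (fun v : 'cV[R]_2 => complexify v) z ->
  exists x y, z 0 ord0 = x%:C /\ z 1 ord0 = y%:C.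
Proof. by move=> [v _ <-]; exists (v 0 ord0), (v 1 ord0); rewrite !mxE. Qed.

Lemma det_mx2 (S : comNzRingType) (M : 'M[S]_2) :
  \det M = M 0 0 * M 1 1 - M 0 1 * M 1 0.
Proof.
rewrite (expand_det_row _ 0) big_ord_recl big_ord1 /cofactor !det_mx11 !mxE /=.
rewrite expr0 expr1 mul1r mulN1r mulrN.
by congr (_ * M _ _ - M _ _ * M _ _); apply/val_inj.
Qed.

(** Here m is the coefficient of t in det (A + t B). For det A = 0 only the first two terms remain,
    which is the hypothesis of [mixed_discriminant_lt0]. *)
Lemma det_commutator A B (a := A 0 0) (b := A 0 1) (c := A 1 0) (d := A 1 1)
    (a' := B 0 0) (b' := B 0 1) (c' := B 1 0) (d' := B 1 1)
    (m := a * d' + a' * d - b * c' - b' * c) :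
  \det (commutator A B) = m * ((a + d) * (a' + d') - m)
    - (a + d) ^+ 2 * (a' * d' - b' * c') - (a' + d') ^+ 2 * (a * d - b * c)
    + 4 * ((a * d - b * c) * (a' * d' - b' * c')).
Proof.
have E i j : commutator A B i j = (A i 0 * B 0 j + A i 1 * B 1 j) -
    (B i 0 * A 0 j + B i 1 * A 1 j) by rewrite -!mulmx2E !mxE.
by rewrite det_mx2 !E /m /a /b /c /d /a' /b' /c' /d'; ring.
Qed.

(* With C the commutator and J the rotation by a right angle, JC is symmetric
   as tr C = 0, definite as det C > 0, and (JC) A is symmetric as tr (C A) = 0. *)
Lemma commutator_symmetrizer A B : 0 < \det (commutator A B) -> exists p q r : R,
  [/\ 0 <= p, 0 <= r, q ^+ 2 < p * r,
      selfadjoint p q r (A 0 0) (A 0 1) (A 1 0) (A 1 1) &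
      selfadjoint p q r (B 0 0) (B 0 1) (B 1 0) (B 1 1)].
Proof.
have E i j : commutator A B i j = (A i 0 * B 0 j + A i 1 * B 1 j) -
    (B i 0 * A 0 j + B i 1 * A 1 j) by rewrite -!mulmx2E !mxE.
rewrite det_mx2; pose C := commutator A B; rewrite -/C => D.
have tC : C 1 1 = - C 0 0 by rewrite /C !E; ring.
have saA : C 1 0 * A 0 1 - C 0 0 * A 1 1 - (- C 0 0 * A 0 0 - C 0 1 * A 1 0) = 0.
  by rewrite /C !E; ring.
have saB : C 1 0 * B 0 1 - C 0 0 * B 1 1 - (- C 0 0 * B 0 0 - C 0 1 * B 1 0) = 0.
  by rewrite /C !E; ring.
rewrite tC in D; move: (C 0 0) (C 0 1) (C 1 0) D saA saB => u v w D saA saB.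
have vw : v * w < 0 by have := sqr_ge0 u; nra.
have [w0|w0] := leP 0 w.
  exists w, (- u), (- v); split=> //; [nra|nra| |]; rewrite /selfadjoint.
    by rewrite -[RHS]saA; ring.
  by rewrite -[RHS]saB; ring.
exists (- w), u, v; split; [lra|nra|nra| |]; rewrite /selfadjoint.
  by rewrite -[RHS]oppr0 -saA; ring.
by rewrite -[RHS]oppr0 -saB; ring.
Qed.

(** The determinant is det A - 1 + i tr A, so its vanishing would make i an eigenvalue of A. *)
Lemma selfadjoint_unitmx p q r A : 0 <= p -> 0 <= r -> q ^+ 2 < p * r ->
    selfadjoint p q r (A 0 0) (A 0 1) (A 1 0) (A 1 1) ->
  complexify A + ('i%C)%:M \in unitmx.
Proof.
move=> p0 r0 pqr sa; rewrite unitmxE unitfE det_mx2 !mxE /=.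
apply/negP => /eqP/eqP; rewrite eq_complex /= => /andP[/eqP H1 /eqP H2].
by apply: (selfadjoint_no_eigen_i p0 r0 pqr sa); lra.
Qed.

Lemma R2_ball_convex r : 0 <= r ->
  polynomially_convex (range (fun v : 'cV[R]_2 => complexify v) `&` closed_euclidean_ball 0 r).
Proof.
move=> r0; have := totally_real_ball_convex (unitmx1 R[i] 2) r0.
suff -> : (fun x : 'cV[R]_2 => 1%:M *m complexify x) = @complexify R 2 1 by [].
by apply: funext => x; rewrite mul1mx.
Qed.

Lemma image_of_R2_0 (M : 'M[R[i]]_2) : image_of_R2 M 0.
Proof. by exists 0 => //; rewrite /complexify map_mx0 mulmx0. Qed.

Lemma R2_0 : range (fun v : 'cV[R]_2 => complexify v) 0.
Proof. by exists 0 => //; rewrite /complexify map_mx0. Qed.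

End Matrices.

Theorem theorem3p1 (R : realType) (A1 A2 : 'M[R]_2)
    (P0 P1 P2 : set 'cV[R[i]]_2) :
  real_plane P0 -> totally_real P0 ->
  real_plane P1 -> totally_real P1 ->
  real_plane P2 -> totally_real P2 ->
  P0 = range (fun x : 'cV[R]_2 => complexify x) ->
  P1 = image_of_R2 (complexify A1 + ('i%C)%:M) ->
  P2 = image_of_R2 (complexify A2 + ('i%C)%:M) ->
  locally_polynomially_convex (P0 `|` P1) 0 ->
  locally_polynomially_convex (P0 `|` P2) 0 ->
  locally_polynomially_convex (P1 `|` P2) 0 ->
  \det A1 = 0 /\ 0 <= \det A2 ->
  0 < \det (commutator A1 A2) ->
  locally_polynomially_convex (P0 `|` P1 `|` P2) 0.
Proof.
move=> _ _ _ _ _ _ -> -> -> [r r0 c01] _ [s s0 c12] [].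
rewrite det_commutator !det_mx2 => d1 d2 dC.
have dC' : 0 < \det (commutator A1 A2) by rewrite det_commutator.
have [p [q [t [p0 t0 pqt sa1 sa2]]]] := commutator_symmetrizer dC'.
have d1' : 0 <= A1 0 0 * A1 1 1 - A1 0 1 * A1 1 0 by rewrite d1.
have [e1 e1P [es1 et1]] := selfadjoint_semidefinite pqt sa1 d1'.
have [e2 e2P [es2 et2]] := selfadjoint_semidefinite pqt sa2 d2.
have [e12|e12] : e2 = e1 \/ e2 = - e1.
  by case: e1P => ->; case: e2P => ->; rewrite ?opprK; [left|right|right|left].
  (* A single h must meet the trace condition of [tilt_plane] for both planes. *)
  pose h := (1 + `|A1 0 0 + A1 1 1| + `|A2 0 0 + A2 1 1|)^-1.
  have n1 := normr_ge0 (A1 0 0 + A1 1 1); have n2 := normr_ge0 (A2 0 0 + A2 1 1).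
  have h0 : 0 < h by rewrite invr_gt0; lra.
  have h1 : h * `|A1 0 0 + A1 1 1| <= 1 by rewrite mulrC ler_pdivrMr; lra.
  have h2 : h * `|A2 0 0 + A2 1 1| <= 1 by rewrite mulrC ler_pdivrMr; lra.
  rewrite e12 in es2 et2.
  have [k1 k10 H1] := tilt_plane p0 t0 pqt sa1 d1' e1P es1 et1 h0 h1.
  have [k2 k20 H2] := tilt_plane p0 t0 pqt sa2 d2 e1P es2 et2 h0 h2.
  have [k [C [k0 C0 H0]]] := tilt_real p0 t0 pqt e1P h0.
  (* The union of P_1 and P_2 goes to the half-plane and P_0 to the sector, so the radius s of that
     pair is used. *)
  exists s => //; rewrite -setUA setUC.
  apply: (kallin_half_plane (psi := tilt p q t e1 h) (ka := Num.min k1 k2) (ltW s0)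
            _ R2_0 _ k0 C0 _ _ c12 (R2_ball_convex (ltW s0))).
  - by left; apply: image_of_R2_0.
  - by rewrite lt_min k10.
  - move=> z [] /image_of_R2_coords[x [y zP]].
      have [? H] := H1 x y z zP; split=> //; apply: le_trans H.
      by apply: ler_wpM2r; rewrite ?sqr_ge0 // ge_min lexx.
    have [? H] := H2 x y z zP; split=> //; apply: le_trans H.
    by apply: ler_wpM2r; rewrite ?sqr_ge0 // ge_min lexx orbT.
  - by move=> z /R2_coords[x [y [z0 z1]]]; apply: H0 z0 z1.
rewrite e12 in es2 et2.
have m0 := mixed_discriminant_lt0 pqt sa1 sa2 d1 d2 e1P es1 et1 es2 et2.
rewrite d1 mul0r !(mulr0, addr0, subr0) in dC.
have [k0 k00 H0] := tilt_kernel_real p0 t0 pqt sa1 d1 e1P es1 et1.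
have [k1 k10 H1] := tilt_kernel_plane1 p0 t0 pqt sa1 d1 e1P es1 et1.
have [h [k [C [h01 kp C0 H2]]]] := tilt_kernel_plane2 p0 t0 pqt sa1 sa2 d1 d2 e1P es1 et1 es2 et2 (m0 dC).
(* The union of P_0 and P_1 goes to the half-plane, with its radius r; P_2 goes to the sector and is
   convex in every ball about 0. *)
exists r => //.
apply: (kallin_half_plane (psi := tilt_kernel p q t (A1 0 0) (A1 0 1) (A1 1 0) (A1 1 1) e1 h)
  (ka := Num.min k0 k1) (ltW r0) _ (image_of_R2_0 _) _ kp C0 _ _ c01
  (totally_real_ball_convex (selfadjoint_unitmx p0 t0 pqt sa2) (ltW r0))).
- by left; apply: R2_0.
- by rewrite lt_min k00.
- move=> z [/R2_coords[x [y [z0 z1]]]|/image_of_R2_coords[x [y zP]]].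
    have [? H] := H0 h x y z (andP h01).1 z0 z1; split=> //; apply: le_trans H.
    by apply: ler_wpM2r; rewrite ?sqr_ge0 // ge_min lexx.
  have [? H] := H1 h x y z h01 zP; split=> //; apply: le_trans H.
  by apply: ler_wpM2r; rewrite ?sqr_ge0 // ge_min lexx orbT.
- by move=> z /image_of_R2_coords[x [y zP]]; apply: H2 zP.
Qed.
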